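(* Let $X,Y,Z$ be sorts of a graded probability space. Assume that $E\in\mathcal{B}_{X\times Y\times Z}$ is $\mu$-stable viewed as a binary relation between $X\times Y$ and $Z$, and the slices $E_z\in\mathcal{B}_{X\times Y}$ are $\mu$-stable for almost all $z\in Z$. Then for every $\varepsilon>0$ there exist finite collections of pairwise-disjoint sets $X_i\in\mathcal{B}^E_X$ for $i\in I$, pairwise-disjoint sets $Y_j\in\mathcal{B}^E_Y$ for $j\in J$ and pairwise-disjoint sets $Z_k\in\mathcal{B}^E_Z$ for $k\in K$ so that: (1) $\mu\left(\bigsqcup_{i\in I}X_i\right)\ge1-\varepsilon\mu(X_{i^*})$ for some $i^*\in I$, $\mu\left(\bigsqcup_{j\in J}Y_j\right)\ge1-\varepsilon\mu(Y_{j^*})$ for some $j^*\in J$, and $\mu\left(\bigsqcup_{k\in K}Z_k\right)\ge1-\varepsilon\mu(Z_{k^*})$ for some $k^*\in K$; (2) $\frac{\mu(E\cap(X_i\times Y_j\times Z_k))}{\mu(X_i\times Y_j\times Z_k)}\in\{0,1\}$ for all $(i,j,k)\in I\times J\times K$.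
   Context: Graded probability space: fix base sets $V_1,\dots,V_k$; a sort is any finite cartesian product of the $V_i$'s, in any order and possibly with repetitions. A ($k$-partite) graded probability space specifies for each sort $X$ a $\sigma$-algebra $\mathcal{B}_X\subseteq\mathcal{P}(X)$ and a countably additive probability measure $\mu_X$ on it (both often written without subscript) such that for all sorts $X,Y$: $\mathcal{B}_{X\times Y}\supseteq\mathcal{B}_X\times\mathcal{B}_Y$ and $\mu_{X\times Y}$ extends the product measure; permuting coordinates preserves measurability and measure; and (Fubini) for $A\in\mathcal{B}_{X\times Y}$, $A_y\in\mathcal{B}_X$ for $\mu_Y$-almost every $y$, $y\mapsto\mu_X(A_y)$ is $\mu_Y$-measurable and $\mu_{X\times Y}(A)=\int_Y\mu_X(A_y)\,d\mu_Y$. Subscripts denote fibers: $E_z=\{(x,y):(x,y,z)\in E\}$. $\mu$-stability: for $R\in\mathcal{B}_{X\times Y}$ and $d\ge1$, let $\mathrm{Tree}^{R,d}\subseteq X^{2^d}\times Y^{2^d-1}$ be the set of tuples $(a_\sigma:\sigma\in2^d)^\frown(b_\sigma:\sigma\in2^{<d})$ with $(a_\sigma,b_{\sigma|_i})\in R\iff\sigma(i)=1$ for all $\sigma\in2^d$ (0-1 sequences of length $d$), $i<d$, where $\sigma|_i$ is the initial segment of length $i$. $R$ is $d$-$\mu$-stable if $\mu(\mathrm{Tree}^{R,d})=0$, and $\mu$-stable if it is $d$-$\mu$-stable for some $d$. Algebras of fibers: let $E\in\mathcal{B}_W$ with $W=\prod_{t\in[K]}V_{i_t}$. For $I\subseteq[K]$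 and $W_I=\prod_{t\in I}V_{i_t}$, let $\mathcal{F}^{0,E}_{W_I}$ be the collection of all fibers $E_{\bar b}\subseteq W_I$, $\bar b\in\prod_{t\in[K]\setminus I}V_{i_t}$, and their complements (all these are taken to be in $\mathcal{B}_{W_I}$). For a sort $S=\prod_{t\in[L]}V_{j_t}$, $\mathcal{F}^{E,N}_S$ is the collection of sets $\{(b_i:i\in[L])\in S:\bigwedge_{\ell\in[N]}(b_i:i\in J_\ell)\in S_\ell\}$ with $J_\ell\subseteq[L]$, $I_\ell\subseteq[K]$, $(j_t:t\in J_\ell)=(i_t:t\in I_\ell)$ and $S_\ell\in\mathcal{F}^{0,E}_{W_{I_\ell}}$. $\mathcal{B}^E_S$ is the $\sigma$-algebra generated by $\bigcup_N\mathcal{F}^{E,N}_S$. Convention: density conditions are only required when the denominator is nonzero. *)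

(* Defs.v *)
From HB Require Import structures.
From mathcomp Require Import all_boot all_order all_algebra.
From mathcomp Require Import all_classical all_reals all_analysis.
From mathcomp Require Import measurable_realfun.

Set Implicit Arguments.
Unset Strict Implicit.
Unset Printing Implicit Defensive.
Import Order.TTheory GRing.Theory Num.Theory.
Import numFieldNormedType.Exports.
Local Open Scope classical_set_scope.
Local Open Scope ring_scope.

(* The sort V_(lab 0) x ... x V_(lab (arity - 1)), for base sets V_0, ..., V_(k-1). *)
Record psort (k : nat) := PSort { arity : nat; lab : 'I_arity -> 'I_k }.

Section Sorts.
Context {k : nat}.
Implicit Types S X Y : psort k.

Definition sreindex S (m : nat) (f : 'I_m -> 'I_(arity S)) : psort k :=
  PSort (fun t => lab (f t)).

Definition scat X Y : psort k :=
  PSort (fun t : 'I_(arity X + arity Y) =>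
    match fintype.split t with inl u => lab u | inr v => lab v end).

(* [enum_val] lists a set of ordinals increasingly, so the coordinates in J
   keep their order. *)
Definition subsort S (J : {set 'I_(arity S)}) : psort k :=
  sreindex (fun t : 'I_#|J| => enum_val t).

(* Coordinates of X^(2^d) x Y^(2^d - 1): {i : 'I_d & i.-tuple bool} is the set
   of 0-1 sequences of length < d. *)
Definition tree_index X Y (d : nat) : finType :=
  ((d.-tuple bool * 'I_(arity X)) +
   ({i : 'I_d & i.-tuple bool} * 'I_(arity Y)))%type.

Definition tree_lab X Y d (t : tree_index X Y d) : 'I_k :=
  match t with inl u => lab u.2 | inr v => lab v.2 end.

Definition tree_sort X Y d : psort k :=
  PSort (fun t : 'I_#|tree_index X Y d| => tree_lab (enum_val t)).

Definition initseg d (s : d.-tuple bool) (i : 'I_d) : {i : 'I_d & i.-tuple bool} :=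
  existT _ i [tuple tnth s (widen_ord (ltnW (ltn_ord i)) t) | t < i].

End Sorts.

(* The base sets of a graded probability space are nonempty, since each sort V_i
   carries a probability measure; taking them pointed loses no generality. *)
Definition pt k (V : 'I_k -> pointedType) (S : psort k) : Type :=
  forall t : 'I_(arity S), V (lab t).

Section Points.
Context {k : nat} {V : 'I_k -> pointedType}.
Implicit Types S X Y : psort k.

Definition preindex S m (f : 'I_m -> 'I_(arity S)) (p : pt V S) :
  pt V (sreindex f) := fun t => p (f t).
Arguments preindex {S m} f p t.

Definition pcat X Y (x : pt V X) (y : pt V Y) : pt V (scat X Y) :=
  fun t =>
    match fintype.split t as s
      return V (match s with inl u => lab u | inr v => lab v end) with
    | inl u => x u
    | inr v => y v
    end.

Definition prestr S (J : {set 'I_(arity S)}) (p : pt V S) :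
  pt V (subsort J) := preindex (fun t : 'I_#|J| => enum_val t) p.
Arguments prestr {S} J p t.

Definition box X Y (A : set (pt V X)) (B : set (pt V Y)) :
  set (pt V (scat X Y)) := [set pcat x y | x in A & y in B].

Definition slice X Y (A : set (pt V (scat X Y))) (y : pt V Y) :
  set (pt V X) := [set x | A (pcat x y)].

Definition tree_point X Y d (a : d.-tuple bool -> pt V X)
    (b : {i : 'I_d & i.-tuple bool} -> pt V Y) : pt V (tree_sort X Y d) :=
  fun t =>
    match enum_val t as u return V (tree_lab u) with
    | inl u => a u.1 u.2
    | inr v => b v.1 v.2
    end.

Definition Tree X Y (E : set (pt V (scat X Y))) (d : nat) :
  set (pt V (tree_sort X Y d)) :=
  [set tree_point ab.1 ab.2 | ab in
    [set ab : (d.-tuple bool -> pt V X) *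
              ({i : 'I_d & i.-tuple bool} -> pt V Y) |
      forall (s : d.-tuple bool) (i : 'I_d),
        E (pcat (ab.1 s) (ab.2 (initseg s i))) <-> tnth s i = true]].

(* The fiber E_b, for b in the product of the coordinates outside I. *)
Definition fiber (W : psort k) (E : set (pt V W)) (I : {set 'I_(arity W)})
    (b : pt V (subsort (~: I)%SET)) : set (pt V (subsort I)) :=
  [set prestr I p | p in [set p | E p /\ prestr (~: I)%SET p = b]].

Definition fiber_family (W : psort k) (E : set (pt V W))
    (I : {set 'I_(arity W)}) : set (set (pt V (subsort I))) :=
  [set A | exists b, A = fiber E b \/ A = ~` fiber E b].

(* The equations [e l] say that the label sequences along J l and I l agree, so
   that the coordinates of b in J l form a point of the sort of S l. *)
Definition fiber_cylinders (W : psort k) (E : set (pt V W)) (S : psort k)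
    (N : nat) : set (set (pt V S)) :=
  [set A | exists (J : 'I_N -> {set 'I_(arity S)})
      (I : 'I_N -> {set 'I_(arity W)})
      (e : forall l, subsort (J l) = subsort (I l))
      (F : forall l, set (pt V (subsort (I l)))),
    (forall l, fiber_family E (F l)) /\
    A = [set b | forall l, F l (ecast T (pt V T) (e l) (prestr (J l) b))]].

Definition fiber_algebra (W : psort k) (E : set (pt V W)) (S : psort k) :
  set (set (pt V S)) := <<s \bigcup_N fiber_cylinders E N >>.

End Points.

Arguments preindex {k V S m} f p t.
Arguments prestr {k V S} J p t.
Arguments tree_point {k V X Y d} a b t.
Arguments Tree {k V X Y} E d p.
Arguments fiber {k V W} E {I} b x.
Arguments fiber_family {k V W} E {I} A.
Arguments fiber_cylinders {k V W} E {S} N A.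
Arguments fiber_algebra {k V W} E {S} A.

Unset Implicit Arguments.

(* [gprod] uses the product sigma-algebra and product measure on pairs, moved to
   scat X Y along the bijection pcat.  In [gperm] the arities m and arity S are
   only propositionally equal, so it also identifies the two bracketings of a
   concatenation of three sorts.  In [gfubini],
   y |-> mu_X(A_y) is only defined almost everywhere; g is a measurable function
   that it agrees with almost everywhere. *)
Record graded_space (R : realType) (k : nat) (V : 'I_k -> pointedType) :=
  GradedSpace {
  gB : forall S : psort k, set (set (pt V S));
  gB_sigma : forall S, sigma_algebra setT (gB S);
  gmu : forall S, probability (g_sigma_algebraType (gB S)) R;
  gprod : forall (X Y : psort k)
      (A : set (g_sigma_algebraType (gB X) * g_sigma_algebraType (gB Y))),
    measurable A ->
    gB (scat X Y) [set pcat q.1 q.2 | q in A] /\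
    gmu (scat X Y) [set pcat q.1 q.2 | q in A] = (gmu X \x gmu Y)%E A;
  gperm : forall (S : psort k) (m : nat) (f : 'I_m -> 'I_(arity S)),
    bijective f -> forall A, gB (sreindex f) A ->
    gB S (preindex f @^-1` A) /\
    gmu S (preindex f @^-1` A) = gmu (sreindex f) A;
  gfubini : forall (X Y : psort k) (A : set (pt V (scat X Y))), gB (scat X Y) A ->
    exists g : g_sigma_algebraType (gB Y) -> \bar R,
    [/\ measurable_fun setT g,
        {ae gmu Y, forall y, gB X (slice A y) /\ gmu X (slice A y) = g y} &
        gmu (scat X Y) A = (\int[gmu Y]_y g y)%E]
}.

Set Implicit Arguments.
Arguments graded_space R {k} V : rename.
Arguments gB {R k V} G {S} A : rename.
Arguments gmu {R k V} G S : rename.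

Section Stability.
Context {R : realType} {k : nat} {V : 'I_k -> pointedType}.
Variable G : graded_space R V.

Definition d_mu_stable X Y (E : set (pt V (scat X Y))) (d : nat) : Prop :=
  gmu G (tree_sort X Y d) (Tree E d) = 0%E.

Definition mu_stable X Y (E : set (pt V (scat X Y))) : Prop :=
  gB G E /\ exists2 d, (1 <= d)%N & d_mu_stable E d.

Definition fibers_measurable (W : psort k) (E : set (pt V W)) : Prop :=
  forall (I : {set 'I_(arity W)}) (b : pt V (subsort (~: I)%SET)),
    gB G (fiber E b).

End Stability.

(* Main.v *)
(* Call A good for a relation Q if for almost every y the fiber Q_y meets A in a
   set that is null or conull in A.  If no positive subset of A is good, then
   splitting repeatedly along positively many fibers puts positive measure on
   trees of every depth; hence for a mu-stable Q every positive set contains a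
   good positive set cut out by fibers, and exhaustion gives a countable cover by
   good sets.

   Apply this to E between X x Y and Z: the good sets A_0, A_1, ... reduce almost
   every z to its pattern {n : A_n contained in E_z mod 0}.  Only countably many
   patterns matter: a pattern in the support which is not a Boolean combination
   of finitely many patterns from a countable dense family produces, by Ramsey,
   arbitrarily long ladders, and binary search along a ladder produces trees of
   positive measure.  So finitely many atoms Z_l cover Z up to the allowed error,
   and E_z is almost constant, equal to some E_(z_l), on each of them.

   Only finitely many relations E_(z_l) remain, each mu-stable between X and Y, so
   the X_i can be chosen good for all of them at once.  A good X_i determines
   the same subset of Y mod 0 as the fiber over a suitable x in X_i, and the Y_j
   are the cells of the finite Boolean algebra generated by these fibers. *)

Require Import Defs.
From HB Require Import structures.
From mathcomp Require Import all_boot all_order all_algebra.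
From mathcomp Require Import all_classical all_reals all_analysis.
From mathcomp Require Import measurable_realfun.
From mathcomp Require Import zify.

Set Implicit Arguments.
Unset Strict Implicit.
Unset Printing Implicit Defensive.
Import Order.TTheory GRing.Theory Num.Theory.
Import numFieldNormedType.Exports.
Local Open Scope classical_set_scope.
Local Open Scope ring_scope.

(** * Points of a sort *)

Section SortPoints.
Context {k : nat} {V : 'I_k -> pointedType}.
Implicit Types S X Y Z : psort k.

(* Coordinates carried together with their label: points of different sorts are
   compared coordinatewise through [tcoord], so that no transport is needed. *)
Definition tcoord S (p : pt V S) (t : 'I_(arity S)) : {c : 'I_k & V c} :=
  Tagged V (p t).

Lemma tcoord_inj S (p q : pt V S) : tcoord p =1 tcoord q -> p = q.
Proof.
move=> h; apply: functional_extensionality_dep => t.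
exact: eq_from_Tagged (h t).
Qed.

Lemma tcoord_pcat_l X Y (x : pt V X) (y : pt V Y) i :
  tcoord (pcat x y : pt V (scat X Y)) (lshift _ i) = tcoord x i.
Proof.
have := unsplitK (inl i : 'I_(arity X) + 'I_(arity Y)); rewrite /= /tcoord /pcat /=.
by move=> ->.
Qed.

Lemma tcoord_pcat_r X Y (x : pt V X) (y : pt V Y) j :
  tcoord (pcat x y : pt V (scat X Y)) (rshift _ j) = tcoord y j.
Proof.
have := unsplitK (inr j : 'I_(arity X) + 'I_(arity Y)); rewrite /= /tcoord /pcat /=.
by move=> ->.
Qed.

(** Pullback of a point along a map of coordinates that respects labels. The cast stays hidden:
    later arguments see it only through [tcoord_ptransport]. *)
Definition ptransport S S' (f : 'I_(arity S') -> 'I_(arity S))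
  (h : forall t, lab (f t) = lab t) (p : pt V S) : pt V S' :=
  fun t => ecast c (V c) (h t) (p (f t)).

Lemma tcoord_ptransport S S' (f : 'I_(arity S') -> 'I_(arity S)) h (p : pt V S) t :
  tcoord (ptransport (f := f) h p : pt V S') t = tcoord p (f t).
Proof. by rewrite /tcoord /ptransport; case: _ / (h t). Qed.

Definition pt0 {S} : pt V S := fun=> point.

Lemma scat_lab_l X Y i : lab (lshift _ i : 'I_(arity (scat X Y))) = lab i.
Proof.
(* The tag of a tagged coordinate is its label, so an equation between tagged coordinates yields one
   between labels. *)
have := congr1 (fun u : {c & V c} => tag u) (tcoord_pcat_l (pt0 : pt V X) (pt0 : pt V Y) i).
by [].
Qed.

Lemma scat_lab_r X Y i : lab (rshift _ i : 'I_(arity (scat X Y))) = lab i.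
Proof.
by have := congr1 (fun u : {c & V c} => tag u) (tcoord_pcat_r (pt0 : pt V X) (pt0 : pt V Y) i).
Qed.

Definition pfst X Y : pt V (scat X Y) -> pt V X := ptransport (@scat_lab_l X Y).
Definition psnd X Y : pt V (scat X Y) -> pt V Y := ptransport (@scat_lab_r X Y).

Lemma tcoord_pfst X Y (p : pt V (scat X Y)) t : tcoord (pfst p) t = tcoord p (lshift _ t).
Proof. exact: tcoord_ptransport. Qed.
Lemma tcoord_psnd X Y (p : pt V (scat X Y)) t : tcoord (psnd p) t = tcoord p (rshift _ t).
Proof. exact: tcoord_ptransport. Qed.

Lemma pcatK1 X Y (x : pt V X) (y : pt V Y) : pfst (pcat x y) = x.
Proof. by apply: tcoord_inj => t; rewrite tcoord_pfst tcoord_pcat_l. Qed.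

Lemma pcatK2 X Y (x : pt V X) (y : pt V Y) : psnd (pcat x y) = y.
Proof. by apply: tcoord_inj => t; rewrite tcoord_psnd tcoord_pcat_r. Qed.

Lemma pcat_eta X Y (p : pt V (scat X Y)) : pcat (pfst p) (psnd p) = p.
Proof.
apply: tcoord_inj => t; rewrite -(splitK t); case: (fintype.split t) => u /=.
  by rewrite tcoord_pcat_l tcoord_pfst.
by rewrite tcoord_pcat_r tcoord_psnd.
Qed.

Lemma boxE X Y (A : set (pt V X)) (B : set (pt V Y)) :
  box A B = [set p | A (pfst p) /\ B (psnd p)].
Proof.
apply/seteqP; split => p.
  by case=> x Ax [y By <-] /=; rewrite pcatK1 pcatK2.
by case=> Ap Bp; exists (pfst p) => //; exists (psnd p) => //; rewrite pcat_eta.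
Qed.

End SortPoints.

Arguments pt0 {k V S} : simpl never.

(** * Null sets and Fubini *)

Section Graded.
Context {R : realType} {k : nat} {V : 'I_k -> pointedType}.
Variable G : graded_space R V.
Implicit Types S X Y Z : psort k.

Notation gB := (gB G).
Notation neg := (negligible (gmu G _)).

Lemma gB_measurable S (A : set (pt V S)) : gB A ->
  measurable (A : set (g_sigma_algebraType (Defs.gB G (S := S)))).
Proof. by move=> h; apply: sub_sigma_algebra. Qed.

Lemma measurable_gB S (A : set (pt V S)) :
  measurable (A : set (g_sigma_algebraType (Defs.gB G (S := S)))) -> gB A.
Proof.
by move=> h; rewrite -(sigma_algebra_id (gB_sigma _ _ _ G S)); exact: h.
Qed.

Lemma gB_setC S (A : set (pt V S)) : gB A -> gB (~` A).
Proof. by move=> /gB_measurable h; apply: measurable_gB; exact: measurableC. Qed.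

Lemma gB_setI S (A B : set (pt V S)) : gB A -> gB B -> gB (A `&` B).
Proof. by move=> /gB_measurable h /gB_measurable h'; apply: measurable_gB; exact: measurableI. Qed.

Lemma gB_setD S (A B : set (pt V S)) : gB A -> gB B -> gB (A `\` B).
Proof. by move=> /gB_measurable h /gB_measurable h'; apply: measurable_gB; exact: measurableD. Qed.

Lemma gB_setU S (A B : set (pt V S)) : gB A -> gB B -> gB (A `|` B).
Proof. by move=> /gB_measurable h /gB_measurable h'; apply: measurable_gB; exact: measurableU. Qed.

Lemma gB_setT S : gB (setT : set (pt V S)).
Proof. by apply: measurable_gB; exact: measurableT. Qed.

(** This is [gperm] for an arbitrary target sort: the equation on tagged coordinates forces the
    labels of [S'], which makes [phi] equal to [preindex f]. *)
Lemma gB_bij S S' (f : 'I_(arity S') -> 'I_(arity S)) (phi : pt V S -> pt V S') :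
  bijective f -> (forall p t, tcoord (phi p) t = tcoord p (f t)) ->
  forall A, gB A -> gB (phi @^-1` A) /\ gmu G S (phi @^-1` A) = gmu G S' A.
Proof.
case: S' f phi => m l' /= f phi bf hphi A.
have el : l' = fun t => lab (f t).
  by apply/funext => t; by have := congr1 (fun u : {c & V c} => tag u) (hphi pt0 t).
subst l'; have -> : phi = preindex f.
  apply/funext => p; apply: (@tcoord_inj _ _ (sreindex f)) => t; exact: hphi.
exact: gperm.
Qed.

Lemma gB_box X Y (A : set (pt V X)) (B : set (pt V Y)) : gB A -> gB B ->
  gB (box A B) /\ gmu G (scat X Y) (box A B) = (gmu G X A * gmu G Y B)%E.
Proof.
move=> /gB_measurable mA /gB_measurable mB.
have [h1 h2] := gprod _ _ _ G _ _ _ (measurableX mA mB).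
have e : box A B = [set pcat q.1 q.2 | q in (A `*` B)].
  apply/seteqP; split => p; first by case=> x Ax [y By <-]; exists (x, y).
  by case=> -[x y] [/= Ax By] <-; exists x => //; exists y.
by rewrite e; split=> //; rewrite h2; exact: product_measure1E.
Qed.

(** The coordinates missed by [f] are collected in [C]. Adding them turns [f] into a bijection,
    under which the preimage of [A] becomes the box of [A] with the whole space over [C]. *)
Lemma gB_preim_inj S S' (f : 'I_(arity S') -> 'I_(arity S)) (phi : pt V S -> pt V S') :
  injective f -> (forall p t, tcoord (phi p) t = tcoord p (f t)) ->
  forall A, gB A -> gB (phi @^-1` A).
Proof.
move=> injf hphi A gA.
pose C := (~: [set f x | x in 'I_(arity S')])%SET.
pose g (t : 'I_(arity (scat S' (subsort C)))) : 'I_(arity S) :=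
  match fintype.split t with inl u => f u | inr v => enum_val v end.
have gl u : g (lshift _ u) = f u.
  by rewrite /g (unsplitK (inl u : 'I_(arity S') + 'I_#|C|)).
have gr u : g (rshift _ u) = enum_val u.
  by rewrite /g (unsplitK (inr u : 'I_(arity S') + 'I_#|C|)).
have bg : bijective g.
  apply: inj_card_bij.
    move=> t t'; rewrite -(splitK t) -(splitK t').
    case: (fintype.split t) => u; case: (fintype.split t') => u' /=.
    - by rewrite !gl => /injf ->.
    - rewrite gl gr => e; have := enum_valP u'.
      by rewrite -e inE imset_f.
    - rewrite gl gr => e; have := enum_valP u.
      by rewrite e inE imset_f.
    - by rewrite !gr => /enum_val_inj ->.
  rewrite !card_ord /= -[X in (X <= _)%N](card_ord (arity S)).
  rewrite -(cardsC [set f x | x in 'I_(arity S')]) card_imset //.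
  by rewrite card_ord.
have hg p t : tcoord (pcat (phi p) (prestr C p) : pt V (scat S' (subsort C))) t
    = tcoord p (g t).
  rewrite -(splitK t); case: (fintype.split t) => u /=.
    by rewrite tcoord_pcat_l gl hphi.
  by rewrite tcoord_pcat_r gr.
have [h _] := gB_bij bg hg (gB_box gA (gB_setT (subsort C))).1.
suff -> : phi @^-1` A = (fun p => pcat (phi p) (prestr C p)) @^-1`
    box A [set: pt V (subsort C)] by [].
by rewrite boxE; apply/seteqP; split => p /=; rewrite pcatK1; [split|case].
Qed.

Lemma negP0 S (A : set (pt V S)) : gB A -> neg A <-> gmu G S A = 0%E.
Proof. by move=> /gB_measurable mA; exact: negligibleP. Qed.

Lemma neg_bigcup_countable S (I : countType) (F : I -> set (pt V S)) :
  (forall i, neg (F i)) -> neg (\bigcup_i F i).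
Proof.
move=> h; pose F' n := if unpickle n is Some i then F i else set0.
have h' n : neg (F' n) by rewrite /F'; case: unpickle => // ; exact: negligible_set0.
apply: negligibleS (negligible_bigcup h').
by move=> p [i _ Fi]; exists (pickle i) => //; rewrite /F' pickleK.
Qed.

Lemma neg_setD_transl S (A B C : set (pt V S)) :
  neg (A `\` B) -> neg (B `\` C) -> neg (A `\` C).
Proof.
move=> h h'; apply: negligibleS (negligibleU h h') => p [Ap nCp].
by case: (pselect (B p)) => Bp; [right|left].
Qed.

(** A nonnegative function has integral zero exactly when it vanishes almost everywhere; here the
    function is the measure of the slice. *)
Lemma fubini0 X Y (N : set (pt V (scat X Y))) : gB N ->
  neg N <-> neg [set y | ~ neg (slice N y)].
Proof.
move=> gN; have [g [mg [D [mD D0 hD]] hN]] := gfubini _ _ _ G _ _ _ gN.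
have D_neg : neg D by exists D; split.
have gok y : ~ D y -> gB (slice N y) /\ gmu G X (slice N y) = g y.
  by move=> nDy; apply: contrapT => h; apply: nDy; apply: hD.
(* [g] is known to be nonnegative only off the null set [D], so its integral is first replaced by
   that of its absolute value. *)
have intE : (\int[gmu G Y]_y g y = \int[gmu G Y]_y `|g y|)%E.
  apply: ae_eq_integral => //; first exact: measurableT_comp.
  exists D; split => // y /= hy; apply: contrapT => nDy; apply: hy => _.
  by have [_ <-] := gok y nDy; rewrite gee0_abs.
rewrite negP0 // hN intE; split.
  move/ae_eq_integral_abs => /(_ measurableT mg) h0.
  apply: negligibleS (negligibleU D_neg h0) => y /= ny.
  case: (pselect (D y)) => Dy; [by left|right => /= hy; apply: ny].
  by have [gs es] := gok y Dy; apply/negP0 => //; rewrite es; apply: hy.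
move=> h; apply/ae_eq_integral_abs => //.
apply: negligibleS (negligibleU D_neg h) => y /= ny.
case: (pselect (D y)) => Dy; [by left|right => /= hy; apply: ny => _].
by have [gs es] := gok y Dy; rewrite -es; apply/negP0.
Qed.

Definition swap X Y (p : pt V (scat X Y)) : pt V (scat Y X) :=
  pcat (psnd p) (pfst p).

Lemma swap_pcat X Y (x : pt V X) (y : pt V Y) : swap (pcat x y) = pcat y x.
Proof. by rewrite /swap pcatK1 pcatK2. Qed.

Lemma swap_mu X Y (N : set (pt V (scat Y X))) : gB N ->
  gB (@swap X Y @^-1` N) /\ gmu G _ (@swap X Y @^-1` N) = gmu G _ N.
Proof.
pose f (t : 'I_(arity Y + arity X)) : 'I_(arity X + arity Y) :=
  match fintype.split t with inl u => rshift _ u | inr v => lshift _ v end.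
pose f' (t : 'I_(arity X + arity Y)) : 'I_(arity Y + arity X) :=
  match fintype.split t with inl u => rshift _ u | inr v => lshift _ v end.
have fl u : f (lshift _ u) = rshift _ u by rewrite /f (unsplitK (inl u)).
have fr u : f (rshift _ u) = lshift _ u by rewrite /f (unsplitK (inr u)).
have fl' u : f' (lshift _ u) = rshift _ u by rewrite /f' (unsplitK (inl u)).
have fr' u : f' (rshift _ u) = lshift _ u by rewrite /f' (unsplitK (inr u)).
apply: (@gB_bij (scat X Y) (scat Y X) f).
  exists f' => t; rewrite -(splitK t); case: (fintype.split t) => u /=;
  by rewrite ?(fl, fr, fl', fr').
move=> p t; rewrite -(splitK t); case: (fintype.split t) => u /=.
  by rewrite tcoord_pcat_l fl tcoord_psnd.
by rewrite tcoord_pcat_r fr tcoord_pfst.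
Qed.

Definition lslice X Y (N : set (pt V (scat X Y))) (x : pt V X) : set (pt V Y) :=
  [set y | N (pcat x y)].

Lemma fubini0_swap X Y (N : set (pt V (scat X Y))) : gB N ->
  neg N <-> neg [set x | ~ neg (lslice N x)].
Proof.
move=> gN; have [gN' eN] := swap_mu gN.
rewrite negP0 // -eN -negP0 // fubini0 //.
suff -> : [set y | ~ neg (slice (@swap Y X @^-1` N) y)] =
  [set x | ~ neg (lslice N x)] by [].
apply/seteqP; split => x /=.
  suff -> : slice (@swap Y X @^-1` N) x = lslice N x by [].
  by apply/seteqP; split => y; rewrite /slice /lslice /= swap_pcat.
suff -> : slice (@swap Y X @^-1` N) x = lslice N x by [].
by apply/seteqP; split => y; rewrite /slice /lslice /= swap_pcat.
Qed.

End Graded.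

(** * Recursive trees *)

Section TreeIndex.
Context {k : nat} {V : 'I_k -> pointedType}.
Variables X Y : psort k.

(** Coordinates of a tree regrouped as left subtree, right subtree, root. With the root as last
    factor, fixing it amounts to taking a [slice]. *)
Fixpoint rtree d : psort k :=
  if d is d'.+1 then scat (scat (rtree d') (rtree d')) Y else X.

Definition root d : {i : 'I_d.+1 & i.-tuple bool} :=
  Tagged (fun i : 'I_d.+1 => i.-tuple bool) (i := ord0) [tuple].

Definition push d (c : bool) (u : {i : 'I_d & i.-tuple bool}) :
    {i : 'I_d.+1 & i.-tuple bool} :=
  Tagged (fun i : 'I_d.+1 => i.-tuple bool) (i := lift ord0 (tag u))
    [tuple of c :: tagged u].

Definition pushi d c (t : tree_index X Y d) : tree_index X Y d.+1 :=
  match t with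
  | inl u => inl ([tuple of c :: u.1], u.2)
  | inr u => inr (push c u.1, u.2)
  end.

Fixpoint tree_code d : 'I_(arity (rtree d)) -> tree_index X Y d :=
  match d with
  | 0 => fun t => inl ([tuple], t)
  | d'.+1 => fun t =>
    match fintype.split t with
    | inl u => match fintype.split u with
               | inl v => pushi false (tree_code v)
               | inr v => pushi true (tree_code v)
               end
    | inr u => inr (root d', u)
    end
  end.

Lemma tree_code_l d u : tree_code (lshift _ (lshift _ u) : 'I_(arity (rtree d.+1))) = pushi false (tree_code u).
Proof.
rewrite /= (unsplitK (inl (lshift _ u) : 'I_(_ + _) + 'I_(arity Y))).
by rewrite (unsplitK (inl u : 'I_(arity (rtree d)) + 'I_(arity (rtree d)))).
Qed.

Lemma tree_code_r d u : tree_code (lshift _ (rshift _ u) : 'I_(arity (rtree d.+1))) = pushi true (tree_code u).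
Proof.
rewrite /= (unsplitK (inl (rshift _ u) : 'I_(_ + _) + 'I_(arity Y))).
by rewrite (unsplitK (inr u : 'I_(arity (rtree d)) + 'I_(arity (rtree d)))).
Qed.

Lemma tree_code_root d u : tree_code (rshift _ u : 'I_(arity (rtree d.+1))) = inr (root d, u).
Proof. by rewrite /= (unsplitK (inr u : 'I_(_ + _) + 'I_(arity Y))). Qed.

Lemma rtree_ind d (P : 'I_(arity (rtree d.+1)) -> Prop) :
  (forall u, P (lshift _ (lshift _ u))) -> (forall u, P (lshift _ (rshift _ u))) ->
  (forall u, P (rshift _ u)) -> forall t, P t.
Proof.
move=> h1 h2 h3 t; rewrite -(splitK t); case: (fintype.split t) => u //=.
by rewrite -(splitK u); case: (fintype.split u).
Qed.

Lemma push_inj d c c' (u u' : {i : 'I_d & i.-tuple bool}) :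
  push c u = push c' u' -> c = c' /\ u = u'.
Proof.
case: u u' => i s [i' s'] /= e.
have ei : i = i'.
  by apply: (@lift_inj _ ord0); exact: (congr1 (fun v : {j : 'I_d.+1 & j.-tuple bool} => tag v) e).
subst i'; have e' := congr1 val (eq_from_Tagged e).
case: e' => -> es; split=> //; congr Tagged; exact: val_inj.
Qed.

Lemma pushi_inj d c c' (u u' : tree_index X Y d) :
  pushi c u = pushi c' u' -> c = c' /\ u = u'.
Proof.
case: u u' => [[s i]|[s i]] [[s' i']|[s' i']] //=.
  by move=> [-> es ->]; split => //; rewrite (_ : s = s') //; apply: val_inj; exact: es.
move=> e; have e' : Some (push c s, i) = Some (push c' s', i').
  exact: (congr1 (fun t : tree_index X Y d.+1 => if t is inr u then Some u else None) e).
have e1 : push c s = push c' s' by exact: (congr1 (fun t => (odflt (push c s, i) t).1) e').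
have e2 : i = i' by exact: (congr1 (fun t => (odflt (push c s, i) t).2) e').
by have [-> ->] := push_inj e1; rewrite e2.
Qed.

Lemma push_root d c (u : {i : 'I_d & i.-tuple bool}) : push c u <> root d.
Proof. by move=> /(congr1 (fun v => val (tag v))). Qed.

Lemma tree_code_inj d : injective (@tree_code d).
Proof.
elim: d => [|d IH] t t'; first by move=> [].
elim/rtree_ind: t => u; elim/rtree_ind: t' => u';
  rewrite ?(tree_code_l, tree_code_r, tree_code_root).
- by move=> /pushi_inj [_ /IH ->].
- by move=> /pushi_inj [].
- by case: (tree_code u) => [[]|[]] //= ? ? [] /push_root.
- by move=> /pushi_inj [].
- by move=> /pushi_inj [_ /IH ->].
- by case: (tree_code u) => [[]|[]] //= ? ? [] /push_root.
- by case: (tree_code u') => [[]|[]] //= ? ? [] /esym /push_root.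
- by case: (tree_code u') => [[]|[]] //= ? ? [] /esym /push_root.
- by move=> [->].
Qed.

Lemma tree_split d (t : tree_index X Y d.+1) :
  (exists c u, t = pushi c u) \/ exists j, t = inr (root d, j).
Proof.
case: t => [[s j]|[[i s] j]].
  left; case/tupleP: s => c s; exists c, (inl (s, j)) => /=.
  by congr (inl (_, _)); exact: val_inj.
case: (unliftP ord0 i) => [i' ei|ei]; subst i.
  left; case/tupleP: s => c s.
  exists c, (inr (Tagged (fun i : 'I_d => i.-tuple bool) s, j)) => /=.
  by congr (inr (_, _)); congr Tagged; exact: val_inj.
by right; exists j; congr (inr (_, _)); congr Tagged; rewrite tuple0.
Qed.

Lemma tree_code_surj d (t : tree_index X Y d) : exists u, tree_code u = t.
Proof.
elim: d t => [|d IH] t.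
  case: t => [[s j]|[[[]]]] //; exists j => /=.
  by rewrite (tuple0 s).
have [[c [u ->]]|[j ->]] := tree_split t; last first.
  by exists (rshift _ j); rewrite tree_code_root.
have [v <-] := IH u; case: c.
  by exists (lshift _ (rshift _ v)); rewrite tree_code_r.
by exists (lshift _ (lshift _ v)); rewrite tree_code_l.
Qed.

Lemma tree_code_bij d : bijective (@tree_code d).
Proof.
have h t : {u | @tree_code d u = t} by apply/cid; exact: tree_code_surj.
exists (fun t => sval (h t)) => t; last by case: (h t).
by apply: tree_code_inj; case: (h _).
Qed.

Definition pushinode T d c (b : {i : 'I_d.+1 & i.-tuple bool} -> T) :=
  fun u => b (push c u).
Definition pushleaf T d c (a : d.+1.-tuple bool -> T) :=
  fun s : d.-tuple bool => a [tuple of c :: s].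

Fixpoint btree d : (d.-tuple bool -> pt V X) ->
    ({i : 'I_d & i.-tuple bool} -> pt V Y) -> pt V (rtree d) :=
  match d with
  | 0 => fun a _ => a [tuple]
  | d'.+1 => fun a b =>
    pcat (pcat (btree (pushleaf false a) (pushinode false b))
               (btree (pushleaf true a) (pushinode true b)))
         (b (root d'))
  end.

Definition tree_fun d (a : d.-tuple bool -> pt V X)
   (b : {i : 'I_d & i.-tuple bool} -> pt V Y) (t : tree_index X Y d) :
   {c : 'I_k & V c} :=
  match t with inl u => tcoord (a u.1) u.2 | inr v => tcoord (b v.1) v.2 end.

Lemma tcoord_btree d a b t : tcoord (btree a b) t = tree_fun a b (@tree_code d t).
Proof.
elim: d a b t => [|d IH] a b t //.
elim/rtree_ind: t => u; rewrite ?(tree_code_l, tree_code_r, tree_code_root) /= ?(tcoord_pcat_l, tcoord_pcat_r) //.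
  by rewrite IH; case: (tree_code u).
by rewrite IH; case: (tree_code u).
Qed.

Lemma tcoord_tree_point d (a : d.-tuple bool -> pt V X) b t :
  tcoord (tree_point a b) t = tree_fun a b (enum_val t).
Proof.
change (Tagged V (match enum_val t as u return V (tree_lab u) with
  | inl u => a u.1 u.2 | inr v => b v.1 v.2 end) = tree_fun a b (enum_val t)).
by case: (enum_val t).
Qed.

Lemma tree_point_surj d (p : pt V (tree_sort X Y d)) :
  exists a b, p = tree_point a b.
Proof.
pose rk t : 'I_(arity (tree_sort X Y d)) := enum_rank (t : tree_index X Y d).
have la s i : lab (rk (inl (s, i))) = lab i by rewrite /= enum_rankK.
have lb s i : lab (rk (inr (s, i))) = lab i by rewrite /= enum_rankK.
exists (fun s => ptransport (la s) p), (fun s => ptransport (lb s) p).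
apply: tcoord_inj => t; rewrite tcoord_tree_point.
have -> : t = rk (enum_val t) by rewrite /rk enum_valK.
rewrite enum_rankK; case: (enum_val t) => [[s i]|[s i]] /=; by rewrite tcoord_ptransport.
Qed.

(** * Recursive form of the tree relation *)

Variable E : set (pt V (scat X Y)).

Fixpoint leaves d (C : set (pt V X)) : set (pt V (rtree d)) :=
  match d with
  | 0 => C
  | d'.+1 => [set t | leaves C (pfst (pfst t)) /\ leaves C (psnd (pfst t))]
  end.

(** The root separates the leaves: those below its 0-branch lie outside its slice of [E], those
    below its 1-branch inside. The subtrees repeat this condition. *)
Fixpoint rTree d : set (pt V (rtree d)) :=
  match d with
  | 0 => setT
  | d'.+1 => [set t |
      [/\ rTree (pfst (pfst t)), rTree (psnd (pfst t)),
          leaves (~` slice E (psnd t)) (pfst (pfst t)) &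
          leaves (slice E (psnd t)) (psnd (pfst t))]]
  end.

Lemma leavesI d A B : leaves A `&` leaves B = @leaves d (A `&` B).
Proof.
elim: d => //= d IH; apply/seteqP; split => t /=.
  by move=> [[h1 h2] [h3 h4]]; rewrite -IH.
by rewrite -IH /= => -[[? ?] [? ?]].
Qed.

Lemma leaves_btree d C a b :
  (@leaves d C) (btree a b) <-> forall s, C (a s).
Proof.
elim: d a b => [|d IH] a b /=; first by split => [h s|]; rewrite ?(tuple0 s).
rewrite !(pcatK1, pcatK2) !IH; split => [[h0 h1] s|h].
  case/tupleP: s => c s; case: c; [move: (h1 s)|move: (h0 s)];
  by rewrite /pushleaf; congr (C (a _)); exact: val_inj.
by split=> s; exact: h.
Qed.

Lemma initseg0 d (s : d.+1.-tuple bool) : initseg s ord0 = root d.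
Proof. by rewrite /initseg /root; congr Tagged; rewrite tuple0. Qed.

Lemma initseg_lift d c (s : d.-tuple bool) i :
  initseg [tuple of c :: s] (lift ord0 i) = push c (initseg s i).
Proof.
rewrite /initseg /push /=; congr Tagged; apply: eq_from_tnth => j.
rewrite !tnth_mktuple.
case: (unliftP ord0 j) => [j' ->|->].
  by rewrite tnthS tnth_mktuple !(tnth_nth true).
by rewrite tnth0 (tnth_nth true).
Qed.

(** Splitting off the first bit: at level 0 every branch meets the root, and at higher levels the
    condition is that of one subtree. *)
Lemma rTree_btree d a b : (@rTree d) (btree a b) <->
  forall (s : d.-tuple bool) (i : 'I_d),
    E (pcat (a s) (b (initseg s i))) <-> tnth s i = true.
Proof.
elim: d a b => [|d IH] a b /=; first by split => // _ s [].
rewrite !(pcatK1, pcatK2).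
have hd c (s : d.-tuple bool) : tnth [tuple of c :: s] ord0 = c by rewrite tnth0.
split.
  move=> [/IH h0 /IH h1 /leaves_btree l0 /leaves_btree l1] s i.
  case/tupleP: s => c s.
  case: (unliftP ord0 i) => [j ->|->].
    rewrite initseg_lift tnthS.
    by case: c; [exact: h1|exact: h0].
  rewrite initseg0 hd; case: c; first by split => // _; exact: l1.
  by split=> // h; case: (l0 s h).
move=> h; split.
- apply/IH => s i; rewrite /pushleaf /pushinode -initseg_lift.
  by have := h [tuple of false :: s] (lift ord0 i); rewrite tnthS.
- apply/IH => s i; rewrite /pushleaf /pushinode -initseg_lift.
  by have := h [tuple of true :: s] (lift ord0 i); rewrite tnthS.
- apply/leaves_btree => s hs; have /= := h [tuple of false :: s] ord0.
  by rewrite initseg0 hd => -[/(_ hs)].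
- apply/leaves_btree => s; have /= := h [tuple of true :: s] ord0.
  by rewrite initseg0 hd => -[_ /(_ erefl)].
Qed.

End TreeIndex.

(** * Good sets *)

Section TreeMeasure.
Context {R : realType} {k : nat} {V : 'I_k -> pointedType}.
Variable G : graded_space R V.
Implicit Types S X Y Z : psort k.

Notation gB := (gB G).
Notation neg := (negligible (gmu G _)).

Lemma gB_preim_pcat S A B (f1 : 'I_(arity A) -> 'I_(arity S))
    (f2 : 'I_(arity B) -> 'I_(arity S))
    (phi1 : pt V S -> pt V A) (phi2 : pt V S -> pt V B) :
  injective f1 -> injective f2 -> (forall i j, f1 i <> f2 j) ->
  (forall p t, tcoord (phi1 p) t = tcoord p (f1 t)) ->
  (forall p t, tcoord (phi2 p) t = tcoord p (f2 t)) ->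
  forall N, gB N -> gB [set p | N (pcat (phi1 p) (phi2 p))].
Proof.
move=> i1 i2 i12 h1 h2 N gN.
pose f (t : 'I_(arity (scat A B))) : 'I_(arity S) :=
  match fintype.split t with inl u => f1 u | inr v => f2 v end.
have fl u : f (lshift _ u) = f1 u.
  by rewrite /f (unsplitK (inl u : 'I_(arity A) + 'I_(arity B))).
have fr u : f (rshift _ u) = f2 u.
  by rewrite /f (unsplitK (inr u : 'I_(arity A) + 'I_(arity B))).
have injf : injective f.
  move=> t t'; rewrite -(splitK t) -(splitK t').
  case: (fintype.split t) => u; case: (fintype.split t') => u' /=;
    rewrite ?fl ?fr => e.
  - by rewrite (i1 _ _ e).
  - by case: (i12 _ _ e).
  - by case: (i12 _ _ (esym e)).
  - by rewrite (i2 _ _ e).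
apply: (gB_preim_inj injf (phi := fun p => pcat (phi1 p) (phi2 p))) gN => p t.
rewrite -(splitK t); case: (fintype.split t) => u /=.
  by rewrite tcoord_pcat_l fl.
by rewrite tcoord_pcat_r fr.
Qed.

Lemma gB_preim_left T T' Y (N : set (pt V (scat T Y))) : gB N ->
  gB [set p : pt V (scat (scat T T') Y) | N (pcat (pfst (pfst p)) (psnd p))].
Proof.
apply: (@gB_preim_pcat (scat (scat T T') Y) T Y
  (fun u => lshift _ (lshift _ u)) (fun u => rshift _ u)).
- by move=> u v /lshift_inj /lshift_inj.
- exact: rshift_inj.
- by move=> i j /eqP; rewrite eq_lrshift.
- by move=> p t; rewrite !tcoord_pfst.
- by move=> p t; rewrite tcoord_psnd.
Qed.

Lemma gB_preim_right T T' Y (N : set (pt V (scat T' Y))) : gB N ->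
  gB [set p : pt V (scat (scat T T') Y) | N (pcat (psnd (pfst p)) (psnd p))].
Proof.
apply: (@gB_preim_pcat (scat (scat T T') Y) T' Y
  (fun u => lshift _ (rshift _ u)) (fun u => rshift _ u)).
- by move=> u v /lshift_inj /rshift_inj.
- exact: rshift_inj.
- by move=> i j /eqP; rewrite eq_lrshift.
- by move=> p t; rewrite tcoord_psnd tcoord_pfst.
- by move=> p t; rewrite tcoord_psnd.
Qed.

Section Trees.
Variables X Y : psort k.

Lemma gB_leaves d C : gB C -> gB (@leaves k V X Y d C).
Proof.
move=> gC; elim: d => //= d IH.
have := (gB_box (gB_box IH IH).1 (gB_setT G Y)).1.
congr (gB _); rewrite !boxE; apply/seteqP; split => t /=; first by case.
by [].
Qed.

Lemma gB_leaves_slice (E : set (pt V (scat X Y))) d : gB E ->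
  gB [set q : pt V (scat (rtree X Y d) Y) | leaves (slice E (psnd q)) (pfst q)].
Proof.
elim: d => [|d IH] gE.
  move: (gE); congr (gB _); apply/seteqP; split => t /=;
  by rewrite /slice /= pcat_eta.
have h := IH gE.
have := gB_setI (gB_preim_left Y (gB_preim_left (rtree X Y d) h))
  (gB_preim_left Y (gB_preim_right (rtree X Y d) h)).
congr (gB _); apply/seteqP; split => t /=; by rewrite !(pcatK1, pcatK2).
Qed.

Variable E : set (pt V (scat X Y)).

Lemma gB_rTree d : gB E -> gB (rTree E (d := d)).
Proof.
move=> gE; elim: d => [|d IH]; first exact: gB_setT.
have := gB_setI (gB_box (gB_box IH IH).1 (gB_setT G Y)).1
  (gB_setI (gB_preim_left (rtree X Y d) (gB_leaves_slice d (gB_setC gE)))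
           (gB_preim_right (rtree X Y d) (gB_leaves_slice d gE))).
congr (gB _); rewrite !boxE; apply/seteqP; split => t /=; rewrite !(pcatK1, pcatK2).
  by move=> [[[? ?] _] [? ?]].
by move=> [? ? ? ?].
Qed.

(** * Rank of a set and measure of its trees *)

Definition rel_at (A : set (pt V X)) d := leaves A `&` rTree E (d := d).

(** Once the root is fixed, the two subtrees are independent: their leaves range over the two halves
    into which the root splits [A]. *)
Lemma slice_rel_at d A y : slice (@rel_at A d.+1) y =
  box (@rel_at (A `\` slice E y) d) (@rel_at (A `&` slice E y) d).
Proof.
rewrite boxE /rel_at setDE -!leavesI; apply/seteqP; split => t;
  rewrite /slice /= !(pcatK1, pcatK2).
  by move=> [[? ?] [? ? ? ?]].
by move=> [[[? ?] ?] [[? ?] ?]].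
Qed.

(** A measured form of the 2-rank of stability theory: each level demands a non-null set of
    splitting points instead of a single one. *)
Fixpoint rank_ge d (A : set (pt V X)) : Prop :=
  if d is d'.+1 then
    ~ neg [set y | rank_ge d' (A `&` slice E y) /\ rank_ge d' (A `\` slice E y)]
  else ~ neg A.

(** Fubini over the root: each splitting [y] gives a product of two tree sets that are positive by
    induction, so a non-null set of such [y] gives a non-null tree set. *)
Lemma rank_ge_rel_at d A : gB E -> gB A ->
  neg [set y | ~ gB (slice E y)] ->
  rank_ge d A -> ~ neg (@rel_at A d).
Proof.
move=> gE + nE; elim: d A => [|d IH] A gA /=.
  by rewrite /rel_at /= setIT.
move=> hbig nr; apply: hbig.
have gr C e : gB C -> gB (@rel_at C e).
  by move=> gC; apply: gB_setI; [exact: gB_leaves|exact: gB_rTree].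
move/(fubini0 (gr A d.+1 gA)) : nr => nr.
apply: negligibleS (negligibleU nE nr) => y /= [b1 b0].
case: (pselect (gB (slice E y))) => gy; last by left.
right=> /=; rewrite slice_rel_at.
have g0 := gr _ d (gB_setD gA gy); have g1 := gr _ d (gB_setI gA gy).
have [gb eb] := gB_box g0 g1.
move=> /(negP0 gb); rewrite eb => /eqP; rewrite mule_eq0 => /orP [/eqP|/eqP] e.
  by apply: (IH _ (gB_setD gA gy) b0); apply/negP0.
by apply: (IH _ (gB_setI gA gy) b1); apply/negP0.
Qed.

Lemma slice_ae : gB E -> neg [set y | ~ gB (slice E y)].
Proof.
move=> gE; have [g [_ + _]] := gfubini _ _ _ G _ _ _ gE.
by apply: negligibleS => y /= ny [].
Qed.

(** [Tree] and [rTree] differ by the permutation of coordinates [tree_code], which preserves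
    measure. *)
Lemma Tree_mu d : gB E ->
  gmu G (tree_sort X Y d) (Tree E d) = gmu G _ (rTree E (d := d)).
Proof.
move=> gE.
pose f (t : 'I_(arity (rtree X Y d))) : 'I_(arity (tree_sort X Y d)) :=
  enum_rank (tree_code t).
have bf : bijective f by apply: bij_comp (enum_rank_bij _) (@tree_code_bij k X Y d).
have hf a b t : tcoord (btree a b) t = tcoord (tree_point (V := V) a b) (f t).
  by rewrite tcoord_btree tcoord_tree_point enum_rankK.
have lf t : lab (f t) = lab t.
  have := congr1 (fun u : {c & V c} => tag u) (hf (fun=> pt0) (fun=> pt0) t).
  by move=> /= <-.
have := (gB_bij bf (tcoord_ptransport lf) (gB_rTree d gE)).2.
move=> <-; congr (gmu G _ _).
have pmapE (a : d.-tuple bool -> pt V X) b : ptransport lf (tree_point a b) = btree a b.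
  by apply: tcoord_inj => t; rewrite tcoord_ptransport hf.
apply/seteqP; split => p /=.
  by move=> [[a b] h <-]; rewrite pmapE; apply/rTree_btree.
have [a [b ->]] := tree_point_surj p.
by rewrite pmapE => /rTree_btree h; exists (a, b).
Qed.

Lemma leaves_setT d : @leaves k V X Y d setT = setT.
Proof. by elim: d => //= d ->; apply/seteqP; split. Qed.

Lemma stable_rank_bounded : mu_stable G E -> exists d, ~ rank_ge d setT.
Proof.
move=> [gE [d _]]; rewrite /d_mu_stable Tree_mu // => h.
exists d => /(rank_ge_rel_at gE (gB_setT _ _) (slice_ae gE)); apply.
rewrite /rel_at leaves_setT setTI; apply/negP0 => //; exact: gB_rTree.
Qed.

Lemma rank_ge_ae_sub d A B : neg (A `\` B) -> rank_ge d A -> rank_ge d B.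
Proof.
elim: d A B => [|d IH] A B h /=.
  move=> nA nB; apply: nA; apply: negligibleS (negligibleU h nB) => x Ax.
  by case: (pselect (B x)) => ?; [right|left].
move=> nA nB; apply: nA; apply: negligibleS nB => y /= [h1 h0]; split.
  by apply: IH h1; apply: negligibleS h => x [[? ?] nx]; split => // ?; apply: nx.
by apply: IH h0; apply: negligibleS h => x [[? ?] nx]; split => // ?; apply: nx.
Qed.

(** * Good sets and their typical points *)

Definition good A := neg [set y | ~ neg (A `&` slice E y) /\ ~ neg (A `\` slice E y)].

Lemma goodS A B : B `<=` A -> good A -> good B.
Proof.
move=> sBA; apply: negligibleS => y /= [h0 h1]; split=> h.
  by apply: h0; apply: negligibleS h; exact: setSI.
by apply: h1; apply: negligibleS h; exact: setSD.
Qed.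

(** If no positive [B] in [P] inside [A] is good, then non-goodness yields a non-null set of
    splittings into two positive halves, which stay in [P]. Iterating gives [A] every rank, against
    stability. *)
Lemma exists_good (P : set (pt V X) -> Prop) :
  mu_stable G E ->
  (forall A y, P A -> P (A `&` slice E y) /\ P (A `\` slice E y)) ->
  forall A, P A -> ~ neg A -> exists B, [/\ B `<=` A, P B, ~ neg B & good B].
Proof.
move=> /stable_rank_bounded [d nd] hP A PA nA; apply: contrapT => hno; apply: nd.
suff : rank_ge d A by apply: rank_ge_ae_sub; rewrite setDT; exact: negligible_set0.
have {hno} : forall B, B `<=` A -> P B -> ~ neg B -> ~ good B.
  by move=> B sB PB nB gB; apply: hno; exists B.
move: d A PA nA; elim=> [|d IH] A PA nA hA //= nb.
apply: (hA A) => //; apply: negligibleS nb => y /= [h1 h0].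
have [P1 P0] := hP A y PA; split; apply: IH => // B sB; apply: hA.
  by move=> x /sB [].
by move=> x /sB [].
Qed.

(** For almost every [y], almost all points of [A] agree on membership in [slice E y]. By Fubini in
    the other order, some [x] in [A] votes with this majority for almost every [y]. *)
Lemma pick_point A : gB E -> gB A -> ~ neg A -> good A ->
  exists2 x, A x & neg [set y | ~ ((E (pcat x y) -> neg (A `\` slice E y)) /\
                        (~ E (pcat x y) -> neg (A `&` slice E y)))].
Proof.
move=> gE gA nA goodA.
have gAT := (gB_box gA (gB_setT G Y)).1.
(* The slice of this set at [y] is [A] minus [slice E y]; off a null set, Fubini makes its measure a
   measurable function of [y]. *)
have gM := gB_setD gAT gE.
have [g [mg [D [mD D0 hD]] _]] := gfubini _ _ _ G _ _ _ gM.
have D_neg : neg D by exists D; split.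
have gok y : ~ D y -> gB (A `\` slice E y) /\ gmu G X (A `\` slice E y) = g y.
  move=> nDy; apply: contrapT => h; apply: nDy; apply: hD => /= h'; apply: h.
  suff <- : slice (box A setT `\` E) y = A `\` slice E y by [].
  rewrite boxE; apply/seteqP; split => x; rewrite /slice /= pcatK1.
    by move=> [[? _] ?].
  by move=> [? ?].
(* Measurable version of the set of [y] for which the majority of [A] lies in [slice E y]. *)
pose H : set (pt V Y) := g @^-1` [set 0%E].
have gH : gB H.
  apply: measurable_gB; have := mg measurableT _ (emeasurable_set1 0%E).
  by rewrite setTI.
(* Points of [A] over [y] that disagree with the majority; goodness makes almost every slice of [N]
   null. *)
pose N := (box A H `\` E) `|` (box A (~` H) `&` E).
have gN : gB N.
  apply: gB_setU; first by apply: gB_setD => //; exact: (gB_box gA gH).1.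
  by apply: gB_setI => //; exact: (gB_box gA (gB_setC gH)).1.
have HP y : ~ D y -> H y <-> neg (A `\` slice E y).
  by move=> /gok [gy ey]; rewrite negP0 // ey.
have nN : neg N.
  apply/fubini0 => //.
  apply: negligibleS (negligibleU D_neg goodA) => y /= hy.
  case: (pselect (D y)) => Dy; [by left|right].
  have nNE : neg (A `\` slice E y) -> neg (slice N y).
    move=> h; apply: negligibleS (h) => x; rewrite /N !boxE /slice /=.
    rewrite !pcatK1 !pcatK2 => -[[[Ax _] nE]|[[_ nH] _]] //.
    by case: nH; apply/HP.
  split=> h; apply: hy; last exact: nNE.
  case: (pselect (H y)) => Hy; first by apply: nNE; apply/HP.
  apply: negligibleS h => x; rewrite /N !boxE /slice /=.
  by rewrite !pcatK1 !pcatK2 => -[[[_ /Hy]]|[[Ax _] Ex]].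
move/(fubini0_swap gN) : nN => nN.
have [x [Ax Nx]] : exists x, A x /\ neg (lslice N x).
  apply: contrapT => h; apply: nA; apply: negligibleS nN => x Ax /= nx.
  by apply: h; exists x.
exists x => //.
apply: negligibleS (negligibleU (negligibleU D_neg goodA) Nx) => y /= hy.
case: (pselect (D y)) => Dy; first by left; left.
have NE : lslice N x y <-> ~ (E (pcat x y) <-> H y).
  rewrite /N !boxE /lslice /= !pcatK1 !pcatK2.
  by case: (pselect (E (pcat x y))) => hE; case: (pselect (H y)) => hH; tauto.
case: (pselect (lslice N x y)) => nxy; [by right|left; right].
have {nxy NE}EH : E (pcat x y) <-> H y by apply: contrapT => /NE.
have {}HP := HP y Dy; move: hy EH HP => /=.
case: (pselect (E (pcat x y))) => hE; case: (pselect (H y)) => hH;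
  case: (pselect (neg (A `&` slice E y))) => h1; tauto.
Qed.

End Trees.
End TreeMeasure.

(** * Exhaustion *)

Section Exhaustion.
Context {R : realType} {k : nat} {V : 'I_k -> pointedType}.
Variable G : graded_space R V.
Implicit Types S X Y Z : psort k.

Notation gB := (gB G).
Notation neg := (negligible (gmu G _)).

Lemma gB_bigcup S (F : nat -> set (pt V S)) : (forall n, gB (F n)) -> gB (\bigcup_n F n).
Proof. by move=> h; apply: measurable_gB; apply: bigcupT_measurable => n; exact: gB_measurable. Qed.

Lemma mu_fin S (A : set (pt V S)) : gB A -> gmu G S A \is a fin_num.
Proof. by move=> /gB_measurable mA; exact: fin_num_measure. Qed.

(** Near-optimal sequences merge into a single one whose union has maximal measure; a positive set
    of [P] left outside would increase it further. *)
Lemma exhaustion S (P : set (pt V S) -> Prop) :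
  (forall A, P A -> gB A) -> (exists A, P A) ->
  (forall F : nat -> set (pt V S), (forall n, P (F n)) -> ~ neg (~` \bigcup_n F n) ->
    exists B, [/\ B `<=` ~` \bigcup_n F n, P B & ~ neg B]) ->
  exists F : nat -> set (pt V S), (forall n, P (F n)) /\ neg (~` \bigcup_n F n).
Proof.
move=> PgB [A0 PA0] hP.
pose m (F : nat -> set (pt V S)) := fine (gmu G S (\bigcup_n F n)).
pose M := [set m F | F in [set F | forall n, P (F n)]].
have gU (F : nat -> set (pt V S)) : (forall n, P (F n)) -> gB (\bigcup_n F n).
  move=> h; apply: gB_bigcup => n; exact: PgB.
have m1 (F : nat -> set (pt V S)) : (forall n, P (F n)) -> m F <= 1.
  move=> /gU g; rewrite -lee_fin fineK ?mu_fin //.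
  by apply: probability_le1; exact: gB_measurable.
have supM : has_sup M.
  split; first by exists (m (fun=> A0)), (fun=> A0).
  by exists 1 => _ [F hF <-]; exact: m1.
have hF n : {F | (forall i, P (F i)) /\ sup M - n.+1%:R^-1 < m F}.
  apply: cid; have n0 : (0 : R) < n.+1%:R^-1 by rewrite invr_gt0.
  by have [_ [F hF <-] h] := sup_adherent n0 supM; exists F.
pose F n := if unpickle n is Some (i, j) then sval (hF i) j else A0.
have PF n : P (F n).
  by rewrite /F; case: unpickle => // -[i j]; case: (hF i) => ? [].
have mF i : m (sval (hF i)) <= m F.
  have g := gU _ (svalP (hF i)).1.
  apply: fine_le; rewrite ?mu_fin //; first exact: gU.
  apply: le_measure; rewrite ?inE; [exact: gB_measurable|by apply: gB_measurable; exact: gU|].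
  by move=> x [j _ hx]; exists (pickle (i, j)) => //; rewrite /F pickleK.
have supF : sup M <= m F.
  apply/ler_addgt0Pr => e e0.
  have [n hn] : exists n : nat, n.+1%:R^-1 < e.
    have := near_infty_natSinv_lt (PosNum e0) => -[n _ /(_ n (leqnn n)) h].
    by exists n.
  rewrite -lerBlDr; apply: le_trans (mF n).
  apply: le_trans (ltW (svalP (hF n)).2).
  by rewrite lerD2l lerN2 ltW.
exists F; split => //; apply: contrapT => /(hP F PF) [B [sB PB nB]].
pose F' n := if n is n'.+1 then F n' else B.
have PF' n : P (F' n) by case: n.
have : m F' <= sup M by apply: ub_le_sup; [exact: supM.2|exists F'].
have -> : m F' = fine (gmu G S B) + m F.
  rewrite /m; have -> : \bigcup_n F' n = B `|` \bigcup_n F n.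
    apply/seteqP; split => x.
      by case=> -[|n] _ h; [left|right; exists n].
    by move=> [h|[n _ h]]; [exists 0%N|exists n.+1].
  rewrite measureU.
  - by rewrite fineD ?mu_fin //; [exact: PgB|exact: gU].
  - by apply: gB_measurable; exact: PgB.
  - by apply: gB_measurable; exact: gU.
  - by apply/seteqP; split => // x [/sB].
apply/negP; rewrite -ltNge; apply: (le_lt_trans supF); rewrite ltrDr.
rewrite fine_gt0 // ltey_eq mu_fin ?andbT; last exact: PgB.
rewrite lt0e measure_ge0 andbT; apply/eqP => h; apply: nB.
by apply/negP0 => //; exact: PgB.
Qed.

(** Disjointification leaves [F 0] unchanged, so the permitted error is a fixed positive number
    before the number of pieces is chosen. *)
Lemma finite_cover S (F : nat -> set (pt V S)) (eps : R) :
  (forall n, gB (F n)) -> ~ neg (F 0%N) -> neg (~` \bigcup_n F n) -> 0 < eps ->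
  exists n : nat, (1 - eps%:E * gmu G S (F 0%N) <=
    gmu G S (\bigcup_(i in [set: 'I_n.+1]) seqDU F i))%E.
Proof.
move=> gF nF hF e0.
have mF n : measurable (F n : set (g_sigma_algebraType (Defs.gB G (S := S)))).
  exact: gB_measurable.
have gD n : measurable (seqDU F n : set (g_sigma_algebraType (Defs.gB G (S := S)))).
  exact: seqDU_measurable.
have mU : measurable (\bigcup_n F n : set (g_sigma_algebraType (Defs.gB G (S := S)))).
  exact: bigcupT_measurable.
have U1 : gmu G S (\bigcup_n F n) = 1%E.
  have := probability_setC (gmu G S) mU.
  rewrite (measure_negligible _ hF); last exact: measurableC.
  move=> h; have : gmu G S (\bigcup_n F n) \is a fin_num by exact: fin_num_measure.
  move: h; case: (gmu G S _) => //= r [] /esym /eqP.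
  by rewrite subr_eq0 => /eqP ->.
have cv : (fun n => (\sum_(0 <= i < n) gmu G S (seqDU F i))%E) @ \oo --> 1%E.
  rewrite -U1 seqDU_bigcup_eq; apply: (@measure_semi_sigma_additive _ _ _ (gmu G S)).
  - exact: gD.
  - exact: trivIset_seqDU.
  - by rewrite -seqDU_bigcup_eq.
have lt1 : (1 - eps%:E * gmu G S (F 0%N) < 1)%E.
  have f := mu_fin (gF 0%N).
  rewrite -(fineK f) -EFinM -EFinB lte_fin ltrBlDr ltrDl mulr_gt0 //.
  rewrite fine_gt0 // ltey_eq f andbT lt0e measure_ge0 andbT.
  by apply/eqP => h; apply: nF; apply/negP0.
have [N _ hN] : \forall n \near \oo,
    (1 - eps%:E * gmu G S (F 0%N) < \sum_(0 <= i < n) gmu G S (seqDU F i))%E.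
  apply: (cv [set y | 1 - eps%:E * gmu G S (F 0%N) < y]%E).
  by apply: open_nbhs_nbhs; split => //; exact: open_ereal_gt_ereal.
exists N; apply: le_trans (ltW (hN N.+1 (leqnSn _))) _.
have -> : \bigcup_(i in [set: 'I_N.+1]) seqDU F i = \big[setU/set0]_(i < N.+1) seqDU F i.
  rewrite -bigcup_mkord; apply/seteqP; split => x [i hi hx].
    by exists i => //=.
  by exists (Ordinal hi).
rewrite (measure_bigsetU (gmu G S) gD (trivIset_seqDU F)).
by rewrite big_mkord.
Qed.

End Exhaustion.

(** * Ladders *)

Section Ramsey.

(** Pairs are coloured in list order, which suits an asymmetric [c]. The induction recurses into a
    large enough colour class of the head, and adds the head to a homogeneous list of that
    colour. *)
Lemma ramsey (T : eqType) (c : rel T) a b (s : seq T) :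
  (2 ^ (a + b) <= size s)%N ->
  exists t, subseq t s /\
    ((size t = a /\ pairwise c t) \/
     (size t = b /\ pairwise (fun x y => ~~ c x y) t)).
Proof.
have [n ab] := ubnP (a + b); elim: n a b s ab => // n IH a b s ab.
case: a ab => [|a] ab; first by exists [::]; split; [exact: sub0seq|left].
case: b ab => [|b] ab; first by exists [::]; split; [exact: sub0seq|right].
case: s => [|x s] /=; first by rewrite leqn0 expn_eq0.
move=> hs.
pose s1 := [seq y <- s | c x y]; pose s2 := [seq y <- s | ~~ c x y].
have ss : (size s1 + size s2 = size s)%N by rewrite !size_filter count_predC.
have : (2 ^ (a + b.+1) <= size s1)%N \/ (2 ^ (a.+1 + b) <= size s2)%N.
  apply/orP; rewrite -[_ || _]negbK negb_or -!ltnNge; apply/negP => /andP [h1 h2].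
  have : ((size s).+1 < 2 ^ (a + b.+1) + 2 ^ (a.+1 + b))%N.
    by rewrite -ss -addnS -addSn leq_add.
  move: hs; rewrite !addSn !addnS !expnS; lia.
case=> h.
  have [|t [sub]] := IH a b.+1 s1 _ h; first by move: ab; lia.
  case=> [[st pt]|[st pt]]; last first.
    exists t; split; last by right.
    apply: subseq_trans (subseq_cons _ _); exact: subseq_trans sub (filter_subseq _ _).
  exists (x :: t); split.
    by rewrite /= eqxx; exact: subseq_trans sub (filter_subseq _ _).
  left; split; first by rewrite /= st.
  rewrite /= pt andbT; apply/allP => y /(mem_subseq sub).
  by rewrite mem_filter => /andP [].
have [|t [sub]] := IH a.+1 b s2 _ h; first by move: ab; lia.
case=> [[st pt]|[st pt]].
  exists t; split; last by left.
  apply: subseq_trans (subseq_cons _ _); exact: subseq_trans sub (filter_subseq _ _).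
exists (x :: t); split.
  by rewrite /= eqxx; exact: subseq_trans sub (filter_subseq _ _).
right; split; first by rewrite /= st.
rewrite /= pt andbT; apply/allP => y /(mem_subseq sub).
by rewrite mem_filter => /andP [].
Qed.

End Ramsey.

(** * Ladders along a limit pattern *)

Section Ladders.
Variables (I : countType) (p : I -> nat -> bool) (q : nat -> bool).

(* [x] is picked after [y] in the construction of a ladder. *)
Let later (x y : nat * nat * I) : bool :=
  [&& p y.2 x.1.1 == p y.2 x.1.2, p x.2 y.1.1 & ~~ p x.2 y.1.2].

Hypothesis dense : forall n, exists u, forall i, (i < n)%N -> p u i = q i.
Hypothesis undetermined : forall r : seq I,
  exists i j, [/\ q i, ~~ q j & forall u, u \in r -> p u i = p u j].

Lemma indices_bounded (s : seq (nat * nat * I)) :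
  exists n, forall x, x \in s -> (x.1.1 < n)%N /\ (x.1.2 < n)%N.
Proof.
elim: s => [|x s [n hn]]; first by exists 0%N.
case: x => -[x1 x2] x3; exists (maxn n (maxn x1 x2).+1) => -[[y1 y2] y3]; rewrite inE => /orP [/eqP [-> -> _]|/hn /= [h1 h2]] /=; split; lia.
Qed.

(** Each new triple has indices [i], [j] that [q] separates but no earlier [u] does, and a [u] that
    copies [q] on every index used so far. It is put at the head, so the list runs from latest to
    earliest. *)
Lemma later_seq N : exists s : seq (nat * nat * I),
  [/\ size s = N, pairwise later s &
    all (fun x => [&& p x.2 x.1.1, ~~ p x.2 x.1.2, q x.1.1 & ~~ q x.1.2]) s].
Proof.
elim: N => [|N [s [sz pw al]]]; first by exists [::].
have [i [j [qi qj hij]]] := undetermined [seq x.2 | x <- s].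
have [n hn] := indices_bounded s.
have [u hu] := dense (maxn n (maxn i j).+1).
have hs x : x \in s -> p u x.1.1 /\ ~~ p u x.1.2.
  move=> xs; have [h1 h2] := hn x xs; have /and4P [_ _ a b] := allP al x xs.
  by rewrite !hu // leq_max ?h1 ?h2.
have ui : p u i = true by rewrite hu //; lia.
have uj : p u j = false by rewrite hu ?(negbTE qj) //; lia.
exists ((i, j, u) :: s); split => /=; first by rewrite sz.
  rewrite pw andbT; apply/allP => x xs; rewrite /later /=.
  have [-> ->] := hs x xs; rewrite !andbT.
  by apply/eqP/hij/mapP; exists x.
by rewrite ui uj qi qj al.
Qed.

(** All values are fixed except those of an earlier [u] at a later pair, where both indices give the
    same value. Ramsey makes this value constant: if it is true the second index of each pair is
    kept, otherwise the first. *)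
Lemma ladder N : exists c e u, forall a b, (a < N)%N -> (b < N)%N ->
  p (u a) (e b) = c (+) (a <= b)%N.
Proof.
have [s [sz pw al]] := later_seq (2 ^ (N + N)).
have := @ramsey _ (fun x y : nat * nat * I => p y.2 x.1.1) N N s.
rewrite sz => /(_ (leqnn _)) [t [sub hc]].
have {}pw := subseq_pairwise sub pw.
have st : size t = N by case: hc => -[].
have [u0 _] := dense 0; pose x0 := (0%N, 0%N, u0).
have al' a : (a < N)%N -> p (nth x0 t a).2 (nth x0 t a).1.1 /\
    ~~ p (nth x0 t a).2 (nth x0 t a).1.2.
  rewrite -st => /(mem_nth x0) /(mem_subseq sub) /(allP al) /and4P [? ? _ _].
  by split.
have pw' a b : (a < b)%N -> (b < N)%N -> later (nth x0 t a) (nth x0 t b).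
  by rewrite -st => ab bt; apply: (pairwiseP x0 pw); rewrite ?inE //; exact: ltn_trans bt.
case: hc => -[_ pc].
  exists true, (fun b => (nth x0 t b).1.2), (fun a => (nth x0 t a).2) => a b aN bN.
  have [ab|ab|<-] := ltngtP a b.
  - by rewrite /=; have /and3P [_ _ /negbTE] := pw' a b ab bN.
  - have /and3P [/eqP <- _ _] := pw' b a ab aN.
    by apply: (pairwiseP x0 pc); rewrite ?inE ?st.
  - by have [_ /negbTE] := al' a aN.
exists false, (fun b => (nth x0 t b).1.1), (fun a => (nth x0 t a).2) => a b aN bN.
have [ab|ab|<-] := ltngtP a b.
- by have /and3P [_ ->] := pw' a b ab bN.
- by apply/negbTE; apply: (pairwiseP x0 pc); rewrite ?inE ?st.
- by have [->] := al' a aN.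
Qed.

End Ladders.

(* Definability of types, for a pattern [q] in the closure of the patterns [p u]. *)
Lemma boolean_combination (I : countType) (p : I -> nat -> bool) (q : nat -> bool) N :
  (forall n, exists u, forall i, (i < n)%N -> p u i = q i) ->
  (forall c (e : nat -> nat) (u : nat -> I), ~ (forall a b, (a < N)%N -> (b < N)%N ->
     p (u a) (e b) = c (+) (a <= b)%N)) ->
  exists (r : seq I) (tab : seq bitseq),
    forall i, q i = ([seq p u i | u <- r] \in tab).
Proof.
move=> dense noladder; apply: contrapT => hno.
have [|c [e [u h]]] := ladder dense _ N; last by case: (noladder c e u).
move=> r; apply: contrapT => hr; apply: hno.
(* The table lists the truth vectors over [r] that some index in [q] realizes. *)
exists r, [seq x <- [seq val t | t <- enum {: (size r).-tuple bool}] |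
  `[< exists2 i, q i & [seq p u i | u <- r] = x >]] => i.
rewrite mem_filter; apply/idP/andP.
  move=> qi; split; first by apply/asboolP; exists i.
  have sr : size [seq p u i | u <- r] == size r by rewrite size_map.
  by apply/mapP; exists (Tuple sr) => //; rewrite mem_enum.
move=> [/asboolP [j qj e] _]; apply: contrapT => /negP nqi; apply: hr.
exists j, i; split=> // u ur.
have [n nr <-] := nthP u ur.
by rewrite -(nth_map u false (fun u => p u j)) // e (nth_map u).
Qed.

(** * Fiber algebras *)

Section FiberAlgebra.
Context {R : realType} {k : nat} {V : 'I_k -> pointedType}.
Variable G : graded_space R V.
Implicit Types S W X Y Z : psort k.

Notation gB := (gB G).

Lemma psort_eq S S' : arity S = arity S' ->
  (forall (i : 'I_(arity S)) (j : 'I_(arity S')), val i = val j -> lab i = lab j) ->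
  S = S'.
Proof.
case: S S' => n l [n' l'] /= e; subst n' => h; congr PSort.
by apply/funext => i; exact: h.
Qed.

Lemma tcoord_ecast S S' (e : S = S') (p : pt V S) t :
  tcoord (ecast T (pt V T) e p) t = tcoord p (cast_ord (esym (congr1 (@arity k) e)) t).
Proof. by case: _ / e t => t; rewrite cast_ord_id. Qed.

Lemma tcoord_prestr S (J : {set 'I_(arity S)}) (p : pt V S) (t : 'I_#|J|) :
  tcoord (prestr J p) t = tcoord p (enum_val t).
Proof. by []. Qed.

Lemma val_enum_val_setT n (t : 'I_#|[set: 'I_n]%SET|) : val (enum_val t) = val t.
Proof.
have h : (t < n)%N by apply: leq_trans (ltn_ord t) _; rewrite cardsT card_ord.
rewrite (enum_val_nth (Ordinal h)) enum_setT -enumT; exact: nth_enum_ord.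
Qed.

Lemma mono_ltn_inj n m (g : 'I_n -> 'I_m) :
  {mono g : i j / (i < j)%N} -> injective g.
Proof.
move=> mg i j e; have := mg i j; have := mg j i; rewrite e ltnn.
by case: (ltngtP i j) => // /val_inj.
Qed.

(** Both lists are strictly increasing and have the same elements. *)
Lemma enum_imset_mono n m (g : 'I_n -> 'I_m) :
  {mono g : i j / (i < j)%N} -> enum (g @: [set: 'I_n])%SET = map g (enum 'I_n).
Proof.
move=> mg.
have ig := mono_ltn_inj mg.
have so n' : sorted (relpre (@nat_of_ord n') ltn) (enum 'I_n').
  by rewrite -sorted_map val_enum_ord iota_ltn_sorted.
apply: (@irr_sorted_eq _ (relpre (@nat_of_ord m) ltn)).
- by move=> ? ? ?; exact: ltn_trans.
- by move=> ?; exact: ltnn.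
- rewrite /enum_mem; apply: sorted_filter; first by move=> ? ? ?; exact: ltn_trans.
  by rewrite -enumT; exact: so.
- rewrite sorted_map (eq_sorted (e' := relpre (@nat_of_ord n) ltn)); first exact: so.
  by move=> i j /=; rewrite mg.
- move=> u; rewrite mem_enum; apply/imsetP/mapP => -[v _ ->]; exists v => //.
  by rewrite mem_enum.
Qed.

(** Fixing the coordinates outside the range of [g] leaves a single fiber of [E]. Monotonicity of
    [g] matches the order of coordinates with that of [subsort], which lists them increasingly. *)
Lemma section_fiber_measurable W (E : set (pt V W)) S (g : 'I_(arity S) -> 'I_(arity W))
    (c : pt V S -> pt V W) :
  fibers_measurable G E -> {mono g : i j / (i < j)%N} ->
  (forall p t, tcoord (c p) (g t) = tcoord p t) ->
  (forall u p p', (forall t, u <> g t) -> tcoord (c p) u = tcoord (c p') u) ->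
  fiber_algebra E [set p | E (c p)] /\ gB [set p | E (c p)].
Proof.
move=> Efib mg hin hout.
pose J := [set: 'I_(arity S)]%SET; pose I := (g @: J)%SET.
have ig := mono_ltn_inj mg.
have cI : #|I| = arity S by rewrite /I card_imset // /J cardsT card_ord.
have valI (t : 'I_#|I|) : enum_val t = g (cast_ord cI t).
  rewrite (enum_val_nth (g (cast_ord cI t))) enum_imset_mono //.
  rewrite (nth_map (cast_ord cI t)); last by rewrite size_enum_ord -cI.
  congr g; apply: val_inj; rewrite [RHS]/= -[RHS]/(val t); apply: nth_enum_ord.
  by rewrite /= -cI.
have cJ : #|J| = arity S by rewrite /J cardsT card_ord.
have valJ (t : 'I_#|J|) : enum_val t = cast_ord cJ t.
  by apply: val_inj; rewrite val_enum_val_setT.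
have labg t : lab (g t) = lab t.
  by have := congr1 (fun u : {c & V c} => tag u) (hin pt0 t).
have e : subsort J = subsort I.
  apply: psort_eq => [|i j]; first by rewrite /= cI cJ.
  move=> ij; rewrite /= valI valJ labg; congr lab; apply: val_inj => /=; exact: ij.
(* By [hout] the fixed coordinates do not depend on the point, so they can be read off at [pt0]. *)
pose b := prestr (~: I)%SET (c pt0).
have tgE p t : tcoord (ecast T (pt V T) e (prestr J p)) t = tcoord p (cast_ord cI t).
  by rewrite tcoord_ecast tcoord_prestr valJ; congr (tcoord p _); exact: val_inj.
have key : [set p | E (c p)] =
    [set p | fiber E b (ecast T (pt V T) e (prestr J p))].
  apply/seteqP; split => p /=.
    move=> Ep; exists (c p); first split => //.
      apply: tcoord_inj => t; apply: hout => t' et; have := enum_valP t.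
      by rewrite et !inE imset_f.
    apply: tcoord_inj => t; rewrite tgE.
    by rewrite tcoord_prestr valI hin.
  move=> [q [Eq qb] qe]; suff -> : c p = q by [].
  apply: tcoord_inj => u; case: (boolP (u \in I)) => uI.
    have /imsetP [t _ ->] := uI.
    rewrite hin.
    have := tgE p (cast_ord (esym cI) t); rewrite -qe cast_ordKV => <-.
    by rewrite tcoord_prestr valI cast_ordKV.
  have uC : u \in (~: I)%SET by rewrite inE.
  pose u' : 'I_(arity (subsort (~: I)%SET)) := enum_rank_in uC u.
  have := congr1 (fun r : pt V (subsort (~: I)%SET) => tcoord r u') qb.
  rewrite /b !tcoord_prestr /u'.
  rewrite enum_rankK_in // => ->; apply: hout => t et.
  by move: uI; rewrite et imset_f.
split.
  apply: sub_sigma_algebra; exists 1%N => //.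
  exists (fun=> J), (fun=> I), (fun=> e), (fun=> fiber E b); split.
    by move=> _; exists b; left.
  rewrite key; apply/seteqP; split => p /=; first by [].
  by move=> /(_ ord0).
rewrite key; apply: (gB_preim_inj (S' := subsort I) (f := cast_ord cI)
  (phi := fun p => ecast T (pt V T) e (prestr J p))).
- exact: cast_ord_inj.
- exact: tgE.
- exact: Efib.
Qed.

(** * Sections of a ternary relation as fibers *)

Section Slices.
Variables X Y Z : psort k.
Variable E : set (pt V (scat (scat X Y) Z)).
Hypothesis Efib : fibers_measurable G E.

Lemma slice_fiber_measurable y z : fiber_algebra E (slice (slice E z) y) /\ gB (slice (slice E z) y).
Proof.
apply: (section_fiber_measurable (E := E) (g := fun t => lshift _ (lshift _ t))
  (c := fun p => pcat (pcat p y) z) Efib).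
- by move=> i j.
- by move=> p t; rewrite !tcoord_pcat_l.
- move=> u p p'; rewrite -(splitK u); case: (fintype.split u) => v /=; last first.
    by rewrite !tcoord_pcat_r.
  rewrite -(splitK v); case: (fintype.split v) => w /= h; first by case: (h w).
  by rewrite !tcoord_pcat_l !tcoord_pcat_r.
Qed.

Lemma lslice_fiber_measurable x z : fiber_algebra E (lslice (slice E z) x) /\ gB (lslice (slice E z) x).
Proof.
apply: (section_fiber_measurable (E := E) (g := fun t => lshift _ (rshift _ t))
  (c := fun p => pcat (pcat x p) z) Efib).
- by move=> i j /=; rewrite ltn_add2l.
- by move=> p t; rewrite tcoord_pcat_l tcoord_pcat_r.
- move=> u p p'; rewrite -(splitK u); case: (fintype.split u) => v /=; last first.
    by rewrite !tcoord_pcat_r.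
  rewrite -(splitK v); case: (fintype.split v) => w /= h; last by case: (h w).
  by rewrite !tcoord_pcat_l.
Qed.

Lemma lslice_outer_fiber_measurable w : fiber_algebra E (lslice E w) /\ gB (lslice E w).
Proof.
apply: (section_fiber_measurable (E := E) (g := fun t => rshift _ t)
  (c := fun p => pcat w p) Efib).
- by move=> i j /=; rewrite ltn_add2l.
- by move=> p t; rewrite tcoord_pcat_r.
- move=> u p p'; rewrite -(splitK u); case: (fintype.split u) => v /= h.
    by rewrite !tcoord_pcat_l.
  by case: (h v).
Qed.

Lemma slice_outer_gB z : gB (slice E z).
Proof.
apply: (proj2 (section_fiber_measurable (E := E) (g := fun t => lshift _ t)
  (c := fun p => pcat p z) Efib _ _ _)).
- by move=> i j.
- by move=> p t; rewrite tcoord_pcat_l.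
- move=> u p p'; rewrite -(splitK u); case: (fintype.split u) => v /= h.
    by case: (h v).
  by rewrite !tcoord_pcat_r.
Qed.

End Slices.

(** * Closure properties of fiber-measurable sets *)

Section Closure.
Context {W : psort k}.
Variable E : set (pt V W).

(** Membership in [gB] is carried along with membership in the fiber algebra, so that both survive
    each set operation together. *)
Definition fiber_measurable S : set (set (pt V S)) := [set A | fiber_algebra E A /\ gB A].

Lemma fiber_measurable_setD S (A B : set (pt V S)) : fiber_measurable A -> fiber_measurable B -> fiber_measurable (A `\` B).
Proof.
move=> [hA gA] [hB gB_]; split; last exact: gB_setD.
pose T := g_sigma_algebraType (\bigcup_N fiber_cylinders E (S := S) N).
exact: (measurableD (hA : measurable (A : set T)) (hB : measurable (B : set T))).
Qed.

Lemma fiber_measurable_setT S : fiber_measurable (setT : set (pt V S)).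
Proof.
split; last exact: gB_setT.
pose T := g_sigma_algebraType (\bigcup_N fiber_cylinders E (S := S) N).
exact: (measurableT : measurable (setT : set T)).
Qed.

Lemma fiber_measurable_setC S (A : set (pt V S)) : fiber_measurable A -> fiber_measurable (~` A).
Proof. by move=> h; rewrite -setTD; apply: fiber_measurable_setD => //; exact: fiber_measurable_setT. Qed.

Lemma fiber_measurable_setI S (A B : set (pt V S)) : fiber_measurable A -> fiber_measurable B -> fiber_measurable (A `&` B).
Proof. by move=> hA hB; rewrite -setDD; do 2?apply: fiber_measurable_setD. Qed.

Lemma fiber_measurable_bigcup S (F : nat -> set (pt V S)) : (forall n, fiber_measurable (F n)) -> fiber_measurable (\bigcup_n F n).
Proof.
move=> h; split; last by apply: gB_bigcup => n; exact: (h n).2.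
pose T := g_sigma_algebraType (\bigcup_N fiber_cylinders E (S := S) N).
exact: (@bigcupT_measurable _ T F (fun n => (h n).1)).
Qed.

Lemma fiber_measurable_bigcap S (F : nat -> set (pt V S)) : (forall n, fiber_measurable (F n)) -> fiber_measurable (\bigcap_n F n).
Proof.
move=> h; rewrite -[X in fiber_measurable X]setCK setC_bigcap; apply: fiber_measurable_setC.
by apply: fiber_measurable_bigcup => n; exact: fiber_measurable_setC.
Qed.

Lemma fiber_measurable_bigcap_fin S (I : finType) (F : I -> set (pt V S)) :
  (forall i, fiber_measurable (F i)) -> fiber_measurable (\bigcap_i F i).
Proof.
move=> h; pose F' n := if unpickle n is Some i then F i else setT.
have -> : \bigcap_i F i = \bigcap_n F' n.
  apply/seteqP; split => x hx.
    by move=> n _; rewrite /F'; case: unpickle => // i; exact: hx.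
  by move=> i _; have := hx (pickle i) Logic.I; rewrite /F' pickleK.
apply: fiber_measurable_bigcap => n; rewrite /F'; case: unpickle => [i|]; first exact: h.
exact: fiber_measurable_setT.
Qed.

Lemma fiber_measurable_seqDU S (F : nat -> set (pt V S)) n : (forall n, fiber_measurable (F n)) -> fiber_measurable (seqDU F n).
Proof.
move=> h; rewrite /seqDU; apply: fiber_measurable_setD => //.
apply: (big_ind (@fiber_measurable S)) => [|A B hA hB|i _]; last exact: h.
  by rewrite -[set0]setCK setC0; apply: fiber_measurable_setC; exact: fiber_measurable_setT.
rewrite -(setCK (A `|` B)) setCU; apply: fiber_measurable_setC.
by apply: fiber_measurable_setI; exact: fiber_measurable_setC.
Qed.

End Closure.
End FiberAlgebra.

(** * Covers by good sets and by atoms *)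

Section Covers.
Context {R : realType} {k : nat} {V : 'I_k -> pointedType}.
Variable G : graded_space R V.
Implicit Types S W X Y Z : psort k.

Notation gB := (gB G).
Notation neg := (negligible (gmu G _)).

Lemma not_neg_setT S : ~ neg (setT : set (pt V S)).
Proof.
move=> /(negP0 (gB_setT _ _)) h.
have := probability_setT (gmu G S); rewrite h => /esym/eqP.
by rewrite onee_eq0.
Qed.

Lemma not_neg_setC S (A : set (pt V S)) : neg (~` A) -> exists x, A x.
Proof.
move=> h; apply: contrapT => hn; apply: (@not_neg_setT S).
by apply: negligibleS h => x _ /= Ax; apply: hn; exists x.
Qed.

(** Goodness passes to subsets, so the finitely many relations can be treated one after another
    inside any positive set; exhaustion then gives the cover. [P] stands for a sigma-algebra that
    contains the slices. *)
Lemma good_cover X Y (L : finType) (Q : L -> set (pt V (scat X Y)))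
    (P : set (pt V X) -> Prop) :
  (forall l : L, mu_stable G (Q l)) ->
  (forall A, P A -> gB A) -> P setT ->
  (forall A, P A -> P (~` A)) ->
  (forall F : nat -> set (pt V X), (forall n, P (F n)) -> P (\bigcup_n F n)) ->
  (forall l A y, P A -> P (A `&` slice (Q l) y) /\ P (A `\` slice (Q l) y)) ->
  exists F : nat -> set (pt V X),
    (forall n, [/\ P (F n), ~ neg (F n) & forall l, good G (Q l) (F n)]) /\
    neg (~` \bigcup_n F n).
Proof.
move=> st PgB PT PC PU Psl.
have step A : P A -> ~ neg A -> exists B,
    B `<=` A /\ [/\ P B, ~ neg B & forall l, good G (Q l) B].
  move=> PA nA.
  suff [B [sB PB nB hB]] : exists B, [/\ B `<=` A, P B, ~ neg B &
      forall l, l \in enum L -> good G (Q l) B].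
    by exists B; split => //; split => // l; apply: hB; rewrite mem_enum.
  elim: (enum L) => [|l s [B [sB PB nB hB]]]; first by exists A; split.
  have [C [sC PC' nC gC]] := exists_good (st l) (fun A y => @Psl l A y) PB nB.
  exists C; split => //; first exact: subset_trans sC sB.
  move=> l'; rewrite inE => /orP [/eqP ->|/hB] //.
  exact: goodS.
apply: (@exhaustion _ _ _ G X (fun A => [/\ P A, ~ neg A & forall l, good G (Q l) A])).
- by move=> A [/PgB].
- have [B [_ hB]] := step setT PT (@not_neg_setT X); exists B; exact: hB.
- move=> F hF nF; have PF : P (~` \bigcup_n F n).
    by apply: (PC); apply: PU => n; case: (hF n).
  have [B [sB [PB nB hB]]] := step _ PF nF.
  by exists B; split.
Qed.

Lemma pick_point_any X Y (E : set (pt V (scat X Y))) A : gB E -> gB A -> good G E A ->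
  exists x, neg [set y | ~ ((E (pcat x y) -> neg (A `\` slice E y)) /\
                        (~ E (pcat x y) -> neg (A `&` slice E y)))].
Proof.
move=> gE gA goodA; case: (pselect (neg A)) => nA; last first.
  by have [x _ h] := pick_point gE gA nA goodA; exists x.
(* For a null [A] both implications hold trivially, so every point serves. *)
exists pt0; apply: negligibleS (@negligible_set0 _ _ _ (gmu G Y)) => y /=; case.
by split => _; apply: negligibleS nA => x [].
Qed.

Section Atoms.
Variables (W Z : psort k) (E : set (pt V (scat W Z))).
Hypothesis gE : gB E.
Hypothesis Estable : mu_stable G E.

(** * Patterns of slices over a cover by good sets *)

Section Patterns.
Variables (A : nat -> set (pt V W)) (w : nat -> pt V W).
Hypothesis nA : forall n, ~ neg (A n).
Hypothesis cover : neg (~` \bigcup_n A n).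
Hypothesis hw : forall n,
  neg [set z | ~ ((E (pcat (w n) z) -> neg (A n `\` slice E z)) /\
                  (~ E (pcat (w n) z) -> neg (A n `&` slice E z)))].

Definition decided := [set z : pt V Z | forall n,
  (E (pcat (w n) z) -> neg (A n `\` slice E z)) /\
  (~ E (pcat (w n) z) -> neg (A n `&` slice E z))].

Lemma decided_ae : neg (~` decided).
Proof.
apply: negligibleS (negligible_bigcup hw) => z /= /existsNP [n h].
by exists n.
Qed.

Definition pattern (z : pt V Z) (n : nat) : bool := `[< E (pcat (w n) z) >].

(** On each [A n], equal patterns make both slices conull or both null, and the [A n] cover. The
    other inclusion follows by symmetry. *)
Lemma pattern_eq_slice z z' : decided z -> decided z' -> pattern z =1 pattern z' ->
  neg (slice E z `\` slice E z').
Proof.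
move=> dz dz' h.
have hn n : neg (A n `&` (slice E z `\` slice E z')).
  case: (pselect (E (pcat (w n) z))) => En.
    have [+ _] := dz' n; move: (h n); rewrite /pattern (asboolT En) => /esym /asboolP En'.
    by move=> /(_ En'); apply: negligibleS => x [? []].
  by have [_ /(_ En)] := dz n; apply: negligibleS => x [? []].
apply: negligibleS (negligibleU cover (negligible_bigcup hn)) => x [h1 h2].
case: (pselect ((\bigcup_n A n) x)) => [[n _ An]|nU]; last by left.
by right; exists n.
Qed.

Definition prefix_set (s : bitseq) :=
  [set z | decided z /\ mkseq (pattern z) (size s) = s].

(** Decided points whose pattern lies in the support of the distribution of patterns: every cylinder
    around it is non-null. *)
Definition support := [set z | decided z /\
  forall n, ~ neg (prefix_set (mkseq (pattern z) n))].

(** There are countably many finite prefixes, so discarding the null cylinders costs a null set. *)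
Lemma support_ae : neg (~` support).
Proof.
pose F (s : bitseq) := [set z | prefix_set s z /\ neg (prefix_set s)].
have hF s : neg (F s).
  case: (pselect (neg (prefix_set s))) => h; first by apply: negligibleS h => z [].
  by apply: negligibleS (@negligible_set0 _ _ _ (gmu G Z)) => z [].
apply: negligibleS (negligibleU decided_ae (neg_bigcup_countable hF)) => z /= nz.
case: (pselect (decided z)) => dz; [right|by left].
apply: contrapT => hz; apply: nz; split => // n h; apply: hz.
by exists (mkseq (pattern z) n) => //; split => //; split => //; rewrite size_mkseq.
Qed.

(* Binary search: the middle node of a ladder separates its two halves. *)
Lemma ladder_rank_ge d lo c (e : nat -> nat) (u : nat -> pt V Z) B :
  (forall a, support (u a)) ->
  (forall a b, (lo <= a < lo + 2 ^ d)%N -> (lo <= b < lo + 2 ^ d)%N ->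
    pattern (u a) (e b) = c (+) (a <= b)%N) ->
  (forall b, (lo <= b < lo + 2 ^ d)%N -> neg (A (e b) `\` B)) ->
  rank_ge G E d B.
Proof.
move=> su; elim: d lo B => [|d IH] lo B hl hB /=.
  move=> nB; have := hB lo; rewrite expn0 addn1 leqnn ltnSn => /(_ isT) h.
  apply: (nA (n := e lo)); apply: negligibleS (negligibleU h nB) => x Ax.
  by case: (pselect (B x)) => ?; [right|left].
pose a := (lo + 2 ^ d)%N.
have d0 : (0 < 2 ^ d)%N by rewrite expn_gt0.
have e2 : (2 ^ d.+1 = 2 ^ d + 2 ^ d)%N by rewrite expnS mul2n addnn.
have ha : (lo <= a < lo + 2 ^ d.+1)%N by rewrite /a e2; lia.
(* A prefix of length [n] covers the index of every rung, so each decided [z] sharing it with [u a]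
   splits the ladder as [u a] does; [support] makes these [z] a non-null set. *)
have [n hn] : exists n, forall b, (b < lo + 2 ^ d.+1)%N -> (e b < n)%N.
  exists (\max_(b < lo + 2 ^ d.+1) e b).+1 => b hb.
  by rewrite ltnS; exact: (leq_bigmax (Ordinal hb)).
have [_ /(_ n)] := su a; move=> + nb; apply; apply: negligibleS nb => z /=.
rewrite /prefix_set /= size_mkseq => -[dz hz].
have pz b : (lo <= b < lo + 2 ^ d.+1)%N -> pattern z (e b) = c (+) (a <= b)%N.
  move=> hb; rewrite -(hl a b) //; have /andP [_ /hn en] := hb.
  by rewrite -(nth_mkseq false (pattern z) en) hz nth_mkseq.
have inside b : (lo <= b < lo + 2 ^ d.+1)%N -> pattern z (e b) ->
    neg (A (e b) `\` (B `&` slice E z)).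
  move=> hb /asboolP Ez; have [/(_ Ez) h _] := dz (e b).
  apply: negligibleS (negligibleU h (hB b hb)) => x [Ax nx].
  by case: (pselect (B x)) => Bx; [left; split => // ?; exact: nx|right].
have outside b : (lo <= b < lo + 2 ^ d.+1)%N -> ~~ pattern z (e b) ->
    neg (A (e b) `\` (B `\` slice E z)).
  move=> hb /asboolPn Ez; have [_ /(_ Ez) h] := dz (e b).
  apply: negligibleS (negligibleU h (hB b hb)) => x [Ax nx].
  case: (pselect (B x)) => Bx; [left; split => //|by right].
  by apply: contrapT => ?; exact: nx.
have half1 b : (lo <= b < lo + 2 ^ d)%N ->
    (lo <= b < lo + 2 ^ d.+1)%N /\ (a <= b)%N = false.
  by rewrite e2 /a => hb; split; lia.
have half2 b : (a <= b < a + 2 ^ d)%N ->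
    (lo <= b < lo + 2 ^ d.+1)%N /\ (a <= b)%N = true.
  by rewrite e2 /a => hb; split; lia.
have hl1 a' b : (lo <= a' < lo + 2 ^ d)%N -> (lo <= b < lo + 2 ^ d)%N ->
    pattern (u a') (e b) = c (+) (a' <= b)%N.
  by move=> /half1 [? _] /half1 [? _]; exact: hl.
have hl2 a' b : (a <= a' < a + 2 ^ d)%N -> (a <= b < a + 2 ^ d)%N ->
    pattern (u a') (e b) = c (+) (a' <= b)%N.
  by move=> /half2 [? _] /half2 [? _]; exact: hl.
(* The sign [c] decides which half of the ladder goes inside the slice. *)
case: c IH hl hl1 hl2 pz => IH hl hl1 hl2 pz; split.
- apply: (IH lo) => // b /half1 [hb ab]; apply: inside => //.
  by rewrite pz // ab.
- apply: (IH a) => // b /half2 [hb ab]; apply: outside => //.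
  by rewrite pz // ab.
- apply: (IH a) => // b /half2 [hb ab]; apply: inside => //.
  by rewrite pz // ab.
- apply: (IH lo) => // b /half1 [hb ab]; apply: outside => //.
  by rewrite pz // ab.
Qed.

(** A pattern in the support is a limit of patterns of the representatives [rep s]. A ladder of
    length [2 ^ d] would give the whole space rank [d], so the pattern is a finite Boolean
    combination of these, and there are countably many such combinations. *)
Lemma countably_many_patterns : exists q : nat -> nat -> bool,
  forall z, support z -> exists m, pattern z =1 q m.
Proof.
have [d nd] := stable_rank_bounded Estable.
have [z0 sz0] := not_neg_setC support_ae.
(* A support point with prefix [s] if there is one, and [z0] otherwise. *)
have hrep (s : bitseq) : {z | support z /\
    ((exists2 z', support z' & mkseq (pattern z') (size s) = s) ->
      mkseq (pattern z) (size s) = s)}.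
  apply: cid; case: (pselect (exists2 z', support z' &
      mkseq (pattern z') (size s) = s)) => [[z' h1 h2]|h]; last by exists z0; split.
  by exists z'.
pose rep s := sval (hrep s).
pose q (c : seq bitseq * seq bitseq) i := [seq pattern (rep u) i | u <- c.1] \in c.2.
exists (fun m => if unpickle m is Some c then q c else fun=> false) => z sz.
have [||r [tab h]] := @boolean_combination bitseq (fun s => pattern (rep s))
    (pattern z) (2 ^ d).
- move=> n; exists (mkseq (pattern z) n) => i ni.
  have [_] := svalP (hrep (mkseq (pattern z) n)); rewrite -/(rep _) size_mkseq.
  move=> /(_ (ex_intro2 _ _ z sz erefl)) /(congr1 (fun s => nth false s i)).
  by rewrite !nth_mkseq.
- move=> c e u hl; apply: nd.
  apply: (@ladder_rank_ge d 0 c e (fun a => rep (u a))) => [a|a b|b].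
  + by case: (svalP (hrep (u a))).
  + by rewrite !add0n /=; exact: hl.
  + by rewrite setDT => _; exact: negligible_set0.
- by exists (pickle (r, tab)) => i; rewrite pickleK /q /= h.
Qed.

End Patterns.

(** Every positive set meets one of the countably many atoms of equal pattern in a positive set, so
    exhaustion covers by sets lying each in one atom. There [pattern_eq_slice] makes all decided
    slices agree up to null sets. *)
Lemma atom_cover (P : set (pt V Z) -> Prop) :
  (forall A, P A -> gB A) -> P setT ->
  (forall A B, P A -> P B -> P (A `\` B)) ->
  (forall F : nat -> set (pt V Z), (forall n, P (F n)) -> P (\bigcup_n F n)) ->
  (forall z, gB (slice E z)) ->
  (forall x, P (lslice E x)) ->
  exists (D : set (pt V Z)) (F : nat -> set (pt V Z)),
    [/\ neg (~` D),
     forall n, P (F n), forall n, ~ neg (F n),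
     forall n z z', D z -> D z' -> F n z -> F n z' -> neg (slice E z `\` slice E z') &
     neg (~` \bigcup_n F n)].
Proof.
move=> PgB PT PD PU gsl Psl.
have PC A : P A -> P (~` A) by move=> PA; rewrite -setTD; exact: PD.
have PI A B : P A -> P B -> P (A `&` B).
  by move=> PA PB; rewrite -setDD; apply: (PD _ _ PA); exact: PD.
have [A [hA cA]] := @good_cover W Z unit (fun=> E) (fun A => gB A) (fun=> Estable)
  (fun _ h => h) (@gB_setT _ _ _ G W) (@gB_setC _ _ _ G W) (@gB_bigcup _ _ _ G W)
  (fun _ _ y gA => conj (gB_setI gA (gsl y)) (gB_setD gA (gsl y))).
have hpick n := pick_point_any gE (let: And3 g _ _ := hA n in g)
  (let: And3 _ _ h := hA n in h tt).
have [w hw] := choice hpick.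
have nA n : ~ neg (A n) by case: (hA n).
have [q hq] := countably_many_patterns nA hw.
(* The [z] with pattern [q m], written as a countable intersection to stay in [P]. *)
pose atom m := \bigcap_n (if q m n then lslice E (w n) else ~` lslice E (w n)).
have Patom m : P (atom m).
  rewrite /atom -[X in P X]setCK setC_bigcap; apply: (PC); apply: PU => n.
  by apply: (PC); case: ifP => _; [|apply: (PC)]; exact: Psl.
have atomP m z : atom m z <-> pattern w z =1 q m.
  split=> [h n|h n _].
    have := h n Logic.I; rewrite /pattern; case: (q m n) => /= h'.
      exact/asboolT.
    exact/asboolF.
  rewrite -h /pattern; case: asboolP => //.
pose PP B := [/\ P B, ~ neg B & exists m, B `<=` atom m].
have step B : P B -> ~ neg B -> exists C, C `<=` B /\ PP C.
  move=> PB nB; apply: contrapT => hno; apply: nB.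
  have h m : neg (B `&` atom m).
    apply: contrapT => hm; apply: hno; exists (B `&` atom m).
    by split; [exact: subIsetl|split; [exact: PI| |exists m; exact: subIsetr]].
  apply: negligibleS (negligibleU (support_ae hw) (negligible_bigcup h)) => z Bz.
  case: (pselect (support A w z)) => sz; [right|by left].
  by have [m /atomP hm] := hq z sz; exists m.
have [||F hF|F [hF cF]] := @exhaustion _ _ _ G Z PP.
- by move=> B [/PgB].
- have [C [_ hC]] := step _ PT (@not_neg_setT Z); exists C; exact: hC.
- move=> nF; have PF : P (~` \bigcup_n F n).
    by apply: (PC); apply: PU => n; case: (hF n).
  by have [C [sC [PC' nC hC]]] := step _ PF nF; exists C; split.
exists (decided A w), F; split.
- exact: decided_ae.
- by move=> n; case: (hF n).
- by move=> n; case: (hF n).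
- move=> n z z' dz dz' Fz Fz'; have [_ _ [m hm]] := hF n.
  apply: (pattern_eq_slice cA dz dz') => i.
  by have /atomP -> := hm _ Fz; have /atomP -> := hm _ Fz'.
- exact: cF.
Qed.

End Atoms.
End Covers.

(** * Densities on boxes *)

Section Assembly.
Context {R : realType} {k : nat} {V : 'I_k -> pointedType}.
Variable G : graded_space R V.
Implicit Types S W X Y Z : psort k.

Notation gB := (gB G).
Notation neg := (negligible (gmu G _)).

Lemma finite_disjoint_cover S W (E : set (pt V W)) (F : nat -> set (pt V S)) (eps : R) :
  (forall n, fiber_measurable G E (F n)) -> ~ neg (F 0%N) -> neg (~` \bigcup_n F n) -> 0 < eps ->
  exists n (D : 'I_n -> set (pt V S)),
    [/\ forall i, fiber_measurable G E (D i), trivIset setT D,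
     forall i, exists m, D i `<=` F m &
     exists i0, (1 - eps%:E * gmu G S (D i0) <= gmu G S (\bigcup_i D i))%E].
Proof.
move=> hF nF cF e0.
have [n hn] := finite_cover (fun m => (hF m).2) nF cF e0.
exists n.+1, (fun i => seqDU F i); split.
- by move=> i; exact: fiber_measurable_seqDU.
- apply/trivIsetP => i j _ _ ij.
  have /trivIsetP h := trivIset_seqDU F.
  by apply: h => //; apply: contra ij => /eqP /val_inj ->.
- by move=> i; exists i; exact: subset_seqDU.
- exists ord0; rewrite (_ : seqDU F (ord0 : 'I_n.+1) = F 0%N) //.
  by rewrite /seqDU /= big_ord0 setD0.
Qed.

(** For almost every [y], the point [x] decides how the slice of [Q] meets [A]; over [B] the
    decision is always containment, and Fubini concludes. *)
Lemma neg_box_setD X Y (Q : set (pt V (scat X Y))) (A : set (pt V X)) (B : set (pt V Y))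
    x : gB Q -> gB A -> gB B -> B `<=` lslice Q x ->
  neg [set y | ~ ((Q (pcat x y) -> neg (A `\` slice Q y)) /\
                  (~ Q (pcat x y) -> neg (A `&` slice Q y)))] ->
  neg (box A B `\` Q).
Proof.
move=> gQ gA gB_ sB h.
apply/fubini0; first by apply: gB_setD => //; exact: (gB_box gA gB_).1.
apply: negligibleS h => y /= ny [h _]; apply: ny.
case: (pselect (B y)) => By.
  apply: negligibleS (h (sB y By)) => u; rewrite boxE /slice /= !(pcatK1, pcatK2).
  by move=> [[Au _] nQ].
apply: negligibleS (@negligible_set0 _ _ _ (gmu G X)) => u.
by rewrite boxE /slice /= !(pcatK1, pcatK2) => -[[_ /By]].
Qed.

(** The same argument with the opposite decision of [x]. *)
Lemma neg_box_setI X Y (Q : set (pt V (scat X Y))) (A : set (pt V X)) (B : set (pt V Y))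
    x : gB Q -> gB A -> gB B -> B `<=` ~` lslice Q x ->
  neg [set y | ~ ((Q (pcat x y) -> neg (A `\` slice Q y)) /\
                  (~ Q (pcat x y) -> neg (A `&` slice Q y)))] ->
  neg (box A B `&` Q).
Proof.
move=> gQ gA gB_ sB h.
apply/fubini0; first by apply: gB_setI => //; exact: (gB_box gA gB_).1.
apply: negligibleS h => y /= ny [_ h]; apply: ny.
case: (pselect (B y)) => By.
  apply: negligibleS (h (sB y By)) => u; rewrite boxE /slice /= !(pcatK1, pcatK2).
  by move=> [[Au _] nQ].
apply: negligibleS (@negligible_set0 _ _ _ (gmu G X)) => u.
by rewrite boxE /slice /= !(pcatK1, pcatK2) => -[[_ /By]].
Qed.

(** Fubini over [z]: for almost every [z] in [C], [A] lies in [Q] and [Q] in [slice E z], both up to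
    null sets. *)
Lemma neg_box_slice_setD W Z (E : set (pt V (scat W Z))) A (C : set (pt V Z)) Q :
  gB E -> gB A -> gB C -> neg (A `\` Q) ->
  neg [set z | C z /\ ~ neg (Q `\` slice E z)] -> neg (box A C `\` E).
Proof.
move=> gE gA gC nQ h.
apply/fubini0; first by apply: gB_setD => //; exact: (gB_box gA gC).1.
apply: negligibleS h => z /= nz.
have Cz : C z.
  apply: contrapT => nC; apply: nz.
  apply: negligibleS (@negligible_set0 _ _ _ (gmu G W)) => u.
  by rewrite boxE /slice /= !(pcatK1, pcatK2) => -[[_ /nC]].
split => // hz; apply: nz; apply: negligibleS (neg_setD_transl nQ hz) => u.
by rewrite boxE /slice /= !(pcatK1, pcatK2) => -[[? _] ?].
Qed.

Lemma density01 S (E P : set (pt V S)) : gB E -> gB P ->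
  neg (P `\` E) \/ neg (P `&` E) ->
  fine (gmu G S P) <> 0 ->
  fine (gmu G S (E `&` P)) / fine (gmu G S P) = 0 \/
  fine (gmu G S (E `&` P)) / fine (gmu G S P) = 1.
Proof.
move=> gE gP h /eqP nP.
have mI := gB_measurable (gB_setI gP gE); have mD := gB_measurable (gB_setD gP gE).
case: h => h; [right|left].
  have -> : gmu G S (E `&` P) = gmu G S P.
    rewrite -[in RHS](setUIDK P E) measureU //.
      by rewrite (measure_negligible mD h) adde0 setIC.
    by apply/seteqP; split => // x [[_ ?] [_]].
  by rewrite divff.
by rewrite setIC (measure_negligible mI h) mul0r.
Qed.

End Assembly.

(** * Choice of the three families and densities on their boxes *)

Theorem theorem8p1 (R : realType) (k : nat) (V : 'I_k -> pointedType)
  (G : graded_space R V) (X Y Z : psort k)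
  (E : set (pt V (scat (scat X Y) Z)))
  (EB : gB G E)
  (Efib : fibers_measurable G E)
  (Estable : mu_stable G (X := scat X Y) (Y := Z) E)
  (Eslices : {ae gmu G Z, forall z,
     mu_stable G (X := X) (Y := Y) (slice E z)})
  (eps : R) (eps_gt0 : 0 < eps) :
  exists (nI nJ nK : nat)
    (Xs : 'I_nI -> set (pt V X))
    (Ys : 'I_nJ -> set (pt V Y))
    (Zs : 'I_nK -> set (pt V Z)),
  [/\ (forall i, fiber_algebra E (Xs i)) /\ trivIset setT Xs,
      (forall j, fiber_algebra E (Ys j)) /\ trivIset setT Ys,
      (forall l, fiber_algebra E (Zs l)) /\ trivIset setT Zs,
      [/\ exists i0, (1 - eps%:E * gmu G X (Xs i0) <=
                        gmu G X (\bigcup_i Xs i))%E,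
          exists j0, (1 - eps%:E * gmu G Y (Ys j0) <=
                        gmu G Y (\bigcup_j Ys j))%E &
          exists l0, (1 - eps%:E * gmu G Z (Zs l0) <=
                        gmu G Z (\bigcup_l Zs l))%E] &
      forall i j l,
        let P := box (box (Xs i) (Ys j)) (Zs l) in
        let mP := fine (gmu G (scat (scat X Y) Z) P) in
        let mEP := fine (gmu G (scat (scat X Y) Z) (E `&` P)) in
        mP <> 0 -> mEP / mP = 0 \/ mEP / mP = 1].
Proof.
have [D [F [nD fF nF eqF cF]]] := @atom_cover _ _ _ G (scat X Y) Z E EB Estable
  (fiber_measurable G E (S := Z)) (fun A h => h.2) (@fiber_measurable_setT _ _ _ G _ E Z)
  (@fiber_measurable_setD _ _ _ G _ E Z) (@fiber_measurable_bigcup _ _ _ G _ E Z)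
  (slice_outer_gB Efib) (lslice_outer_fiber_measurable Efib).
have [nK [Zs [fZ tZ sZ cZ]]] := finite_disjoint_cover fF (nF 0%N) cF eps_gt0.
(* These [z] lie in [D], where [eqF] compares slices, and have a stable slice; almost every [z] is
   among them. *)
pose D' := D `&` [set z | mu_stable G (slice E z)].
have nD' : negligible (gmu G Z) (~` D').
  by rewrite setCI; apply: negligibleU => //; exact: Eslices.
(* A representative for each [Zs l], whose slice agrees up to null sets with almost every slice over
   [Zs l]. If [Zs l] misses [D'] it is null, and any stable slice serves. *)
have hz l : exists z, mu_stable G (slice E z) /\
    negligible (gmu G Z) [set z' | Zs l z' /\
      ~ (negligible (gmu G _) (slice E z `\` slice E z') /\
         negligible (gmu G _) (slice E z' `\` slice E z))].
  have [m sm] := sZ l.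
  case: (pselect (exists z, D' z /\ Zs l z)) => [[z [[Dz st] zl]]|h].
    exists z; split => //; apply: negligibleS nD => z' /= [z'l ne] Dz'; apply: ne.
    by split; apply: (eqF m) => //; exact: sm.
  have [z [_ st]] := not_neg_setC nD'.
  exists z; split => //; apply: negligibleS nD' => z' /= [z'l _] Dz'; apply: h.
  by exists z'.
have [zr hzr] := choice hz.
pose Q l := slice E (zr l).
have gQ l : gB G (Q l) by exact: slice_outer_gB.
(* Only the finitely many relations [Q l] remain, so one cover of [X] can be good for all of
   them. *)
have [A [hA cA]] := @good_cover _ _ _ G X Y 'I_nK Q (fiber_measurable G E (S := X))
  (fun l => (hzr l).1) (fun A h => h.2) (@fiber_measurable_setT _ _ _ G _ E X)
  (@fiber_measurable_setC _ _ _ G _ E X) (@fiber_measurable_bigcup _ _ _ G _ E X)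
  (fun l A y h => conj (fiber_measurable_setI h (slice_fiber_measurable Efib y (zr l)))
                       (fiber_measurable_setD h (slice_fiber_measurable Efib y (zr l)))).
have fA n : fiber_measurable G E (A n) by case: (hA n).
have nA0 : ~ negligible (gmu G X) (A 0%N) by case: (hA 0%N).
have [nI [Xs [fX tX sX cX]]] := finite_disjoint_cover fA nA0 cA eps_gt0.
(* A typical point for each pair of a piece [Xs i] and a relation [Q l]; its fiber is the subset of
   [Y] that [Xs i] determines up to a null set. *)
have hx (il : 'I_nI * 'I_nK) := pick_point_any (gQ il.2) (fX il.1).2
  (let: ex_intro m sm := sX il.1 in goodS sm (let: And3 _ _ h := hA m in h il.2)).
have [x {}hx] := choice hx.
pose T := {ffun 'I_nI * 'I_nK -> bool}.
(* Cells of the Boolean algebra generated by the fibers over the typical points, some of them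
   possibly empty. *)
pose cell (s : T) := \bigcap_il
  (if s il then lslice (Q il.2) (x il) else ~` lslice (Q il.2) (x il)).
have fcell s : fiber_measurable G E (cell s).
  apply: fiber_measurable_bigcap_fin => il; have h := lslice_fiber_measurable Efib (x il) (zr il.2).
  by case: ifP => _ //; exact: fiber_measurable_setC.
pose Ys (j : 'I_#|T|) := cell (enum_val j).
have UY : \bigcup_j Ys j = setT.
  apply/seteqP; split => // y _.
  pose s : T := [ffun il => `[< lslice (Q il.2) (x il) y >]].
  exists (enum_rank s) => //; rewrite /Ys enum_rankK => il _.
  by rewrite /s ffunE; case: asboolP.
exists nI, #|T|, nK, Xs, Ys, Zs; split.
- by split => // i; case: (fX i).
- split=> [j|]; first by case: (fcell (enum_val j)).
  apply/trivIsetP => i j _ _ ij; apply/seteqP; split => // y [yi yj].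
  move/negP: ij; apply; apply/eqP/enum_val_inj/ffunP => il.
  have := yi il Logic.I; have := yj il Logic.I.
  by case: (enum_val i il); case: (enum_val j il).
- by split => // i; case: (fZ i).
(* The cells cover everything, so any [j0] satisfies the bound. *)
- split => //; exists (enum_rank [ffun=> true]).
  rewrite UY probability_setT leeBlDr ?fin_numM ?mu_fin //; last exact: (fcell _).2.
  by rewrite leeDl // mule_ge0 // lee_fin ltW.
move=> i j l P mP mEP.
have gX := (fX i).2; have gY : gB G (Ys j) := (fcell (enum_val j)).2.
have gZ := (fZ l).2; have gXY := (gB_box gX gY).1.
apply: density01 => //; first exact: (gB_box gXY gZ).1.
have hil := hx (i, l); have bad := (hzr l).2.
(* A cell lies on one side of each generating fiber, in particular of that for the pair [(i, l)]. *)
have : Ys j `<=` lslice (Q l) (x (i, l)) \/ Ys j `<=` ~` lslice (Q l) (x (i, l)).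
  case e : (enum_val j (i, l)); [left|right] => y /(_ (i, l) Logic.I); by rewrite e.
case=> sY; [left|right].
  apply: (neg_box_slice_setD EB gXY gZ (neg_box_setD (gQ l) gX gY sY hil)).
  apply: negligibleS bad => z [zl nz]; split => // -[h _]; exact: nz.
(* The outside case is the inside case for the complements of [E] and [Q l]. *)
rewrite -[E in _ `&` E]setCK -setDE.
apply: (@neg_box_slice_setD _ _ _ G _ _ (~` E) _ _ (~` Q l) (gB_setC EB) gXY gZ).
  by rewrite setDE setCK; exact: (neg_box_setI (gQ l) gX gY sY hil).
apply: negligibleS bad => z [zl nz]; split => // -[_ h]; apply: nz.
by apply: negligibleS h => u [? nn]; split => //; exact: contrapT.
Qed.
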